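(* Let $t\in(0,\frac12)$. For every $\delta>0$, $$\lim_{n\to\infty}-\frac{1}{n^{1-2t}}\log\beta_{e^{-nD(W_0\|W_1)+n^{1-t}\delta}}(W_1^{\times n}\times P_1\|W_0^{\times n}\times P_0)=\frac{\delta^2}{2\frac{d^2\phi}{d\theta^2}(0)}.$$ That is, for every $r>0$, as $n\to\infty$, $$-\log\beta_{e^{-n^{1-2t}r}}(W_0^{\times n}\times P_0\|W_1^{\times n}\times P_1)=D(W_0\|W_1)\,n-\sqrt{2\frac{d^2\phi}{d\theta^2}(0)\,r}\;n^{1-t}+o(n^{1-t}).$$
   Context: $\mathcal X$ is a finite set. A transition matrix $W$ on $\mathcal X$ has entries $W(x|\bar x)\ge0$ with $\sum_xW(x|\bar x)=1$ for each $\bar x$. $W_0\ne W_1$ are irreducible and ergodic (i.e. irreducible and aperiodic) transition matrices on $\mathcal X$ with the same support; $P_0,P_1$ are probability distributions on $\mathcal X$ with the same support. $W_i^{\times n}\times P_i$ is the distribution on $\mathcal X^{n+1}$ of the Markov chain $(X_1,\dots,X_{n+1})$ with $X_1\sim P_i$ and $\Pr(X_{k+1}=x|X_k=\bar x)=W_i(x|\bar x)$. For distributions $Q_1,Q_0$ on the same finite set, $\beta_\epsilon(Q_1\|Q_0):=\min_T\{\mathsf E_{Q_0}[1-T]\mid\mathsf E_{Q_1}[T]\le\epsilon\}$, the minimum being over all $[0,1]$-valued functions $T$ (randomized tests). $\phi(\theta)$ is the logarithm of the Perron-Frobenius eigenvalue of the matrix $W_0(x|\bar x)^{1-\theta}W_1(x|\bar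 x)^{\theta}$ (zero outside the common support), i.e. of $W_0(x|\bar x)e^{\theta g(x,\bar x)}$ with $g=\log(W_1/W_0)$. $D(W_0\|W_1):=\frac{d}{ds}\varphi(1+s)|_{s=0}$, where $\varphi(1+s)$ is the logarithm of the Perron-Frobenius eigenvalue of the matrix $W_0(x|\bar x)^{1+s}W_1(x|\bar x)^{-s}$. *)

(* Defs.v *)
From HB Require Import structures.
From mathcomp Require Import all_boot all_order all_algebra.
From mathcomp Require Import complex.
From mathcomp Require Import all_classical all_reals all_analysis.

Set Implicit Arguments.
Unset Strict Implicit.
Unset Printing Implicit Defensive.

Import Order.TTheory GRing.Theory Num.Theory.
Import numFieldNormedType.Exports.
Local Open Scope classical_set_scope.
Local Open Scope ring_scope.

(* Conditional probabilities are written [W x y] for W(x|y): the second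
   argument is the conditioning state, so that the columns of W sum to 1. *)

Definition is_distribution (R : realType) (Y : finType) (P : Y -> R) : Prop :=
  (forall x, 0 <= P x) /\ \sum_x P x = 1.

Definition is_transition (R : realType) (X : finType) (W : X -> X -> R) : Prop :=
  forall y, is_distribution (fun x => W x y).

Definition mx_of (R : realType) (X : finType) (W : X -> X -> R) : 'M[R]_#|X| :=
  \matrix_(i, j) W (enum_val i) (enum_val j).

(* The (x, y) entry of the n-th power of W, i.e. W^n(x|y). *)
Definition nstep (R : realType) (X : finType) (W : X -> X -> R) (n : nat)
    (x y : X) : R :=
  (mx_of W ^+ n) (enum_rank x) (enum_rank y).

Definition irreducible_mx (R : realType) (X : finType) (W : X -> X -> R) : Prop :=
  forall x y, exists2 n, (0 < n)%N & 0 < nstep W n x y.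

(* The gcd of the return times of every state is 1. *)
Definition aperiodic_mx (R : realType) (X : finType) (W : X -> X -> R) : Prop :=
  forall (x : X) (d : nat),
    (forall n, (0 < n)%N -> 0 < nstep W n x x -> (d %| n)%N) -> d = 1%N.

Definition ergodic_mx (R : realType) (X : finType) (W : X -> X -> R) : Prop :=
  irreducible_mx W /\ aperiodic_mx W.

(* W^{xn} x P: the law of the path (X_1, ..., X_{n+1}), where X_1 has law P. *)
Definition chain (R : realType) (X : finType) (W : X -> X -> R) (P : X -> R)
    (n : nat) (s : n.+1.-tuple X) : R :=
  P (tnth s ord0) *
  \prod_(k < n) W (tnth s (lift ord0 k)) (tnth s (widen_ord (leqnSn n) k)).
Arguments chain {R X} W P n s.

Definition is_test (R : realType) (Y : finType) (T : Y -> R) : Prop :=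
  forall y, 0 <= T y <= 1.

(* The minimum over the compact set of randomized tests, taken as an infimum
   in R; the set is nonempty for eps >= 0 (T = 0) and bounded below by 0. *)
Definition beta (R : realType) (Y : finType) (eps : R) (Q1 Q0 : Y -> R) : R :=
  inf [set b | exists T : Y -> R,
         [/\ is_test T, \sum_y Q1 y * T y <= eps
           & b = \sum_y Q0 y * (1 - T y)]].

(* The Perron-Frobenius eigenvalue is the real eigenvalue that dominates the
   modulus of every complex eigenvalue; such a number is unique if it exists. *)
Definition is_PF_eigenvalue (R : realType) (n : nat) (A : 'M[R]_n) (r : R) : Prop :=
  eigenvalue A r /\
  forall z : complex R,
    eigenvalue (map_mx (real_complex R) A) z -> `|z| <= real_complex R r.

Definition PF_eigenvalue (R : realType) (n : nat) (A : 'M[R]_n) : R :=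
  xget 0 [set r | is_PF_eigenvalue A r].

(* The matrix W0(x|y)^a W1(x|y)^b, zero outside the common support. *)
Definition tilt (R : realType) (X : finType) (W0 W1 : X -> X -> R) (a b : R)
    (x y : X) : R :=
  if (W0 x y == 0) || (W1 x y == 0) then 0 else W0 x y `^ a * W1 x y `^ b.

Definition phi (R : realType) (X : finType) (W0 W1 : X -> X -> R) (theta : R) : R :=
  ln (PF_eigenvalue (mx_of (tilt W0 W1 (1 - theta) theta))).

Definition rel_entropy (R : realType) (X : finType) (W0 W1 : X -> X -> R) : R :=
  derive1 (fun s : R => ln (PF_eigenvalue (mx_of (tilt W0 W1 (1 + s) (- s))))) 0.

(* Main.v *)
(* On the support, log(W1/W0) and log(P1/P0) make the log-likelihood ratio S_n
   of the two chains an additive functional. Tilting W0 by exp(theta log(W1/W0))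
   and pairing the path measure with the positive left Perron eigenvector, which
   stays bounded away from 0 for theta near 0, gives
     log E_0[exp(theta S_n)] = n phi(theta) + O(1)  uniformly near theta = 0.
   The eigenvectors solve a linear system whose matrix, lambda - A + (all ones),
   is always invertible, so the eigenvalue is as smooth as the entries of A; a
   second-order Taylor expansion at 0 turns the estimate above into convergence
   of the cumulant generating functions of the centred S_n, at speed n^(1-2t), to
   that of a Gaussian with variance phi''(0), which is positive because otherwise
   log(W1/W0) would be a coboundary and W0 = W1. Chernoff bounds and exponential
   tilting then yield the moderate deviation principle for S_n under the first
   chain, and comparison with threshold tests transfers it to beta. *)
Require Import Defs.
From mathcomp Require Import all_boot all_order all_algebra.
From mathcomp Require Import complex ring lra.
From mathcomp Require Import all_classical all_reals all_analysis.

Set Implicit Arguments.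
Unset Strict Implicit.
Unset Printing Implicit Defensive.

Import Order.TTheory GRing.Theory Num.Theory.
Import numFieldNormedType.Exports.
Local Open Scope classical_set_scope.
Local Open Scope ring_scope.

(** * Perron-Frobenius theory of irreducible nonnegative matrices *)

(** Regularity looks circular: the linear system for the eigenvectors contains the eigenvalue, and
    differentiating the eigenvalue seems to need the eigenvectors. The circle is broken one degree
    at a time. Entrywise comparison of tilted matrices makes the eigenvalue continuous, hence the
    eigenvectors continuous; an exact increment formula then makes the eigenvalue differentiable
    with an explicit derivative, hence the eigenvectors differentiable, hence that derivative
    differentiable. The two bounds on t act separately. With a_n = n^(1-2t) and b_n = n^(1-t), t <
    1/2 sends a_n to infinity, which removes the O(1) error in the cumulant generating function. And
    t > 0 sends b_n / a_n = n^t to infinity: moving a likelihood threshold by a fixed multiple of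
    b_n changes the likelihood ratio by a factor that beats every probability of order exp(- K a_n).
    This is why general randomized tests gain nothing over threshold tests at this scale. *)

Lemma cvg_bigsum {R : realType} {I T : Type} {F : set_system T} {FF : Filter F}
    (r : seq I) (f : I -> T -> R) (l : I -> R) :
  (forall i, f i x @[x --> F] --> l i) ->
  \sum_(i <- r) f i x @[x --> F] --> \sum_(i <- r) l i.
Proof. by move=> fl; apply: cvg_big => // -[a b]; exact: add_continuous. Qed.

(* Irreducibility: [0 < A x y] is an edge from y to x, and no proper nonempty set
   of states is closed under edges. *)
Definition connected_graph {R : realType} {X : finType} (A : X -> X -> R) :=
  forall S : {set X}, S != finset.set0 ->
    (forall x y, y \in S -> 0 < A x y -> x \in S) -> S = finset.setT.

Lemma nstepS {R : realType} {X : finType} (W : X -> X -> R) n x y :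
  nstep W n.+1 x y = \sum_z W x z * nstep W n z y.
Proof.
rewrite /nstep exprS mxE (reindex_onto enum_rank enum_val) /=; last first.
  by move=> i _; rewrite enum_valK.
apply: eq_big => [z|z _]; first by rewrite enum_rankK eqxx.
by rewrite /mx_of mxE !enum_rankK.
Qed.

Lemma nstep0 {R : realType} {X : finType} (W : X -> X -> R) x y :
  nstep W 0 x y = (x == y)%:R.
Proof. by rewrite /nstep expr0 mxE (inj_eq enum_rank_inj). Qed.

(** A positive entry of a power is a path of edges, and a closed set containing its start contains
    its end. *)
Lemma irreducible_connected {R : realType} {X : finType} (W : X -> X -> R) :
  (forall x y, 0 <= W x y) -> irreducible_mx W -> connected_graph W.
Proof.
move=> W0 irr S /set0Pn[y yS] cl; apply/setP => x; rewrite inE.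
have nstep_ge0 n a b : 0 <= nstep W n a b.
  elim: n a => [|n IH] a; first by rewrite nstep0.
  by rewrite nstepS sumr_ge0 // => z _; rewrite mulr_ge0.
have [n _] := irr x y; elim: n x => [|n IH] x.
  by rewrite nstep0; case: eqP => [->|]; rewrite ?yS ?ltxx.
rewrite nstepS => /gt_eqF/negbT; rewrite psumr_neq0; last first.
  by move=> z _; rewrite mulr_ge0.
case/hasP => z _ /= hz; have := nstep_ge0 n z y; rewrite le_eqVlt.
case/predU1P => [h|h]; first by rewrite -h mulr0 ltxx in hz.
by apply: (cl _ z); [apply: IH | rewrite pmulr_lgt0 in hz].
Qed.

(** The complement of a set closed under reversed edges is closed under edges. This transfers right
    eigenvector results to left ones. *)
Lemma connected_tr {R : realType} {X : finType} (A : X -> X -> R) :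
  connected_graph A -> connected_graph (fun x y => A y x).
Proof.
move=> irr S S0 cl; apply/eqP; apply: contraT => ST.
have : (~: S)%SET = finset.setT.
  apply: irr => [|x y]; first by rewrite -finset.setCT (inj_eq (@finset.setC_inj _)).
  by rewrite !inE => yS Axy; apply: contra yS => xS; apply: (cl _ x).
move/(congr1 (@finset.setC X)); rewrite finset.setCK finset.setCT => h.
by rewrite h eqxx in S0.
Qed.

Section perron.
Context {R : realType} {X : finType} (A : X -> X -> R).
Hypothesis A_ge0 : forall x y, 0 <= A x y.
Hypothesis A_irr : connected_graph A.

Let mulv (v : X -> R) x := \sum_y A x y * v y.

(** The support of [v] is closed under edges: an edge from the support into a zero of [v] would make
    the left side of the eigenvector equation positive there. *)
Lemma eigvec_gt0 (r : R) (v : X -> R) : (forall x, 0 <= v x) ->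
  (exists x, v x != 0) -> (forall x, \sum_y A x y * v y = r * v x) ->
  forall x, 0 < v x.
Proof.
move=> v0 [x0 vx0] Av x.
suff : [set x | 0 < v x]%SET = finset.setT by move/setP/(_ x); rewrite !inE.
apply: A_irr; first by apply/set0Pn; exists x0; rewrite inE lt0r vx0 v0.
move=> {}x y; rewrite !inE => vy Axy; rewrite lt0r v0 andbT.
apply/eqP => vx; have := Av x; rewrite vx mulr0; apply/eqP.
rewrite psumr_neq0; last by move=> z _; rewrite mulr_ge0.
by apply/hasP; exists y; rewrite ?mem_index_enum //= mulr_gt0.
Qed.

(* As long as the set of strict inequalities is proper, some edge leaves it;
   slightly raising the coordinate at the source of that edge enlarges the set. *)
Lemma strict_subeigvec (r : R) (v : X -> R) : 0 <= r ->
  (forall x, 0 <= v x) -> (forall x, r * v x <= mulv v x) ->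
  (exists x, r * v x < mulv v x) ->
  exists2 w : X -> R, (forall x, 0 <= w x) & forall x, r * w x < mulv w x.
Proof.
move=> r0; have [k] := ubnP #|[set x | r * v x >= mulv v x]%SET|.
elim: k v => // k IH v lek v0 sub [x0 hx0].
pose S := [set x | r * v x < mulv v x]%SET.
have [ST|SNT] := eqVneq S finset.setT.
  by exists v => // x; have := finset.in_setT x; rewrite -ST inE.
have [x [y [xS yS Axy]]] : exists x y, [/\ x \notin S, y \in S & 0 < A x y].
  apply: contrapT => H; move/eqP: SNT; apply; apply: A_irr.
    by apply/set0Pn; exists x0; rewrite inE.
  move=> x y yS Axy; apply: contrapT => /negP xS; apply: H.
  by exists x, y.
pose d := mulv v y - r * v y.
have d0 : 0 < d by move: yS; rewrite inE subr_gt0.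
(* Small enough that [r * e < d], so the inequality at [y] stays strict after its coordinate is
   raised by [e]. *)
pose e := d / (2 * (r + 1)).
have e0 : 0 < e by rewrite divr_gt0 // mulr_gt0 // ltr_wpDl.
have re : r * e < d.
  rewrite /e mulrA ltr_pdivrMr; last by rewrite mulr_gt0 // ltr_wpDl.
  by rewrite mulrC ltr_pM2l //; nra.
pose w z := v z + e * (z == y)%:R.
have mw z : mulv w z = mulv v z + e * A z y.
  rewrite /mulv /w; under eq_bigr do rewrite mulrDr.
  rewrite big_split /=; congr (_ + _).
  rewrite (bigD1 y) //= eqxx big1 ?addr0; first by rewrite mulr1 mulrC.
  by move=> i /negPf ->; rewrite !mulr0.
have sw z : r * w z <= mulv w z.
  rewrite mw /w; have [->|zy] := eqVneq z y.
    have := mulr_ge0 (ltW e0) (A_ge0 y y); rewrite mulrDr mulr1; move: re; rewrite /d; lra.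
  rewrite mulr0 addr0; apply: le_trans (sub z) _.
  by rewrite lerDl mulr_ge0 // ltW.
have ssw z : z \in S -> r * w z < mulv w z.
  rewrite inE mw /w; have [->|zy] := eqVneq z y => h.
    have := mulr_ge0 (ltW e0) (A_ge0 y y); rewrite mulrDr mulr1; move: re; rewrite /d; lra.
  rewrite mulr0 addr0; apply: lt_le_trans h _.
  by rewrite lerDl mulr_ge0 // ltW.
have xw : r * w x < mulv w x.
  rewrite mw /w; have [xy|xy] := eqVneq x y; first by rewrite xy yS in xS.
  rewrite mulr0 addr0; apply: le_lt_trans (sub x) _.
  by rewrite ltrDl mulr_gt0.
apply: (IH w) => //; last by exists x.
- rewrite -ltnS; apply: leq_trans lek; apply: proper_card.
  apply/properP; split.
    apply/fintype.subsetP => z; rewrite !inE !leNgt; apply: contra => h.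
    by apply: ssw; rewrite inE.
  by exists x; [move: xS; rewrite !inE -leNgt | rewrite inE -ltNge].
- by move=> z; rewrite addr_ge0 // mulr_ge0 // ltW.
Qed.

(* Collatz-Wielandt: [r] is the largest rho such that rho v <= A v for some v in
   the simplex; it exists by compactness, and strict_subeigvec forces equality. *)
Lemma perron_right (x0 : X) : exists (r : R) (v : X -> R),
  [/\ 0 <= r, forall x, 0 < v x, \sum_x v x = 1 &
      forall x, \sum_y A x y * v y = r * v x].
Proof.
pose n := #|X|.
pose f (v : 'rV[R]_n) x : R := v ord0 (enum_rank x).
pose M := \sum_x \sum_y A x y.
pose good (v : X -> R) (rho : R) := [/\ forall x, 0 <= v x, \sum_x v x = 1,
   0 <= rho & forall x, rho * v x <= mulv v x].
have good_le1 v rho : good v rho -> forall x, v x <= 1.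
  move=> [v0 v1 _ _] x; rewrite -v1 (bigD1 x) //= lerDl sumr_ge0 //.
have good_leM v (rho : R) : good v rho -> rho <= M.
  move=> g; have [v0 v1 _ s] := g.
  rewrite -[rho]mulr1 -v1 mulr_sumr; apply: ler_sum => x _.
  apply: le_trans (s x) _; apply: ler_sum => y _.
  by rewrite ler_piMr // (good_le1 _ _ g).
have goodN (v : X -> R) (rho : R) : 0 <= rho -> (forall x, 0 <= v x) -> (exists x, v x != 0) ->
    (forall x, rho * v x <= mulv v x) -> exists w, good w rho.
  move=> r0 v0 [x vx] s.
  have V0 : 0 < \sum_x v x.
    rewrite lt0r sumr_ge0 // andbT psumr_neq0 //; apply/hasP.
    by exists x; rewrite ?mem_index_enum //= lt0r vx v0.
  exists (fun x => v x / \sum_x v x); split => //.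
  - by move=> z; rewrite divr_ge0 // ltW.
  - by rewrite -mulr_suml divff // gt_eqF.
  - move=> z; rewrite /mulv /=; under [leRHS]eq_bigr do rewrite mulrA.
    by rewrite -mulr_suml mulrA ler_pM2r ?invr_gt0.
pose K := [set p : 'rV[R]_n * R | good (f p.1) p.2].
have fcont x : continuous (fun p : 'rV[R]_n * R => f p.1 x).
  move=> p; apply: (@continuous_comp _ _ _ (@fst 'rV[R]_n R) (fun v => f v x)).
    exact: cvg_fst.
  exact: coord_continuous.
have scont : continuous (fun p : 'rV[R]_n * R => p.2) by move=> p; exact: cvg_snd.
have Kcl : closed K.
  have -> : K = (\bigcap_(x in [set: X]) [set p | 0 <= f p.1 x])
     `&` [set p | \sum_x f p.1 x = 1] `&` [set p | 0 <= p.2] `&`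
     (\bigcap_(x in [set: X]) [set p | 0 <= mulv (f p.1) x - p.2 * f p.1 x]).
    apply/seteqP; split => p /=.
      move=> [a b c d]; split; [split; [split|]|] => //= [x _|x _].
        exact: a.
      by rewrite /= subr_ge0.
    move=> [[[a b] c] d]; split => //.
      by move=> x; apply: a.
    by move=> x; have := d x I; rewrite /= subr_ge0.
  have cge (F : 'rV[R]_n * R -> R) : continuous F -> closed [set p | 0 <= F p].
    by move=> cF; apply: (@preimage_closed _ _ F [set y | 0 <= y]) => //; exact: closed_ge.
  have csum (F : X -> 'rV[R]_n * R -> R) :
     (forall x, continuous (F x)) -> continuous (fun p => \sum_x F x p).
    by move=> cF p; apply: cvg_bigsum => x; exact: cF.
  apply: closedI; first apply: closedI; first apply: closedI.
  - by apply: closed_bigI => x _; apply: cge.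
  - by apply: (@preimage_closed _ _ (fun p => \sum_x f p.1 x) [set y | y = 1]);
      [move=> p _; apply: csum => x; exact: fcont | exact: closed_eq].
  - by apply: cge; apply: scont.
  - apply: closed_bigI => x _; apply: cge => p; apply: cvgB.
      by apply: cvg_bigsum => y; apply: cvgM; [exact: cvg_cst|exact: fcont].
    by apply: cvgM; [exact: scont| exact: fcont].
have Kcp : compact K.
  pose Bx := [set v : 'rV[R]_n | forall i, `[0, 1]%classic (v ord0 i)].
  have cB : compact Bx.
    by apply: (@rV_compact R n (fun=> `[0, 1]%classic)) => _; apply: segment_compact.
  apply: subclosed_compact Kcl (compact_setX cB (@segment_compact R 0 M)) _.
  move=> [v rho] /= g; split => /=.
    move=> i; have := good_le1 _ _ g (enum_val i); have [/(_ (enum_val i)) h _ _ _] := g.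
    by move: h; rewrite /f enum_valK /= in_itv /= => -> ->.
  by rewrite in_itv /= (good_leM _ _ g) andbT; case: g.
have toK v rho : good v rho -> K (\row_i v (enum_val i), rho).
  rewrite /K /=; suff -> : f (\row_i v (enum_val i)) = v by [].
  by apply/funext => x; rewrite /f mxE enum_rankK.
have K0 : K !=set0.
  have [|x|w gw] := @goodN (fun=> 1) 0 (lexx _) (fun=> ler01).
  - by exists x0; rewrite oner_neq0.
  - by rewrite mul0r sumr_ge0 // => y _; rewrite mulr1.
  by exists (\row_i w (enum_val i), 0); apply: toK.
have [v [r [[v0 v1 r0 s] cmax]]] : exists (v : X -> R) (r : R),
    good v r /\ forall w rho, good w rho -> rho <= r.
  have [|[v r] /set_mem Kc cmax] :=
      @compact_EVT_max _ R (fun p : 'rV[R]_n * R => p.2) _ K0 Kcp.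
    by apply: continuous_subspaceT; apply: scont.
  by exists (f v), r; split => // w rho g; have := cmax _ (mem_set (toK _ _ g)).
have Av x : \sum_y A x y * v y = r * v x.
  apply/eqP; rewrite eq_le s andbT leNgt; apply/negP => h.
  have [|w w0 ws] := strict_subeigvec r0 v0 s; first by exists x.
  (* The uniform slack of the strict inequalities; with [w z <= T] for every [z], raising [r] by
     [m / T] uses up at most [m], which contradicts maximality. *)
  pose m := \big[Num.min/1]_z (mulv w z - r * w z).
  have m0 : 0 < m by apply: lt_bigmin => // z _; rewrite subr_gt0.
  pose T := \sum_z w z + 1.
  have T0 : 0 < T by rewrite ltr_wpDl // sumr_ge0.
  have [z wz] : exists z, w z != 0.
    apply: contrapT => H; have w00 z : w z = 0.
      by apply/eqP; apply: contrapT => /negP hh; apply: H; exists z.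
    by have := ws x; rewrite /mulv w00 mulr0 big1 ?ltxx // => y _; rewrite w00 mulr0.
  have rT : 0 <= r + m / T by rewrite addr_ge0 // divr_ge0 // ltW.
  have [||w' /cmax] := goodN w (r + m / T) rT w0.
  - by exists z.
  - move=> y; rewrite mulrDl -lerBrDl.
    apply: (@le_trans _ _ m); last by apply: bigmin_le_cond.
    rewrite -mulrA ler_piMr ?(ltW m0) // mulrC ler_pdivrMr // mul1r.
    rewrite /T (bigD1 y) //= -addrA lerDl addr_ge0 // sumr_ge0 //.
  - by rewrite gerDl leNgt divr_gt0.
exists r, v; split => //; apply: eigvec_gt0 Av => //.
apply: contrapT => H; have /eqP := v1; rewrite big1 ?(eq_sym 0) ?oner_eq0 //.
by move=> x _; apply/eqP; apply: contrapT => /negP hh; apply: H; exists x.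
Qed.

(** Subtract from [w] the multiple of [v] given by the least ratio [w / v]: the difference is a
    nonnegative eigenvector with a zero, so by [eigvec_gt0] it vanishes identically. *)
Lemma eigvec_unique (r : R) (v w : X -> R) : (forall x, 0 < v x) ->
  (forall x, \sum_y A x y * v y = r * v x) ->
  (forall x, \sum_y A x y * w y = r * w x) ->
  exists k, forall x, w x = k * v x.
Proof.
move=> v0 Av Aw; have [[x0 _]|noX] := pselect (exists x : X, True); last first.
  by exists 0 => x; case: noX; exists x.
have [x1 _ hx1] := @Order.TotalTheory.arg_minP _ _ _ x0 xpredT (fun x => w x / v x) erefl.
exists (w x1 / v x1) => x.
apply/eqP; rewrite -subr_eq0; apply: contrapT => /negP hx.
pose z x := w x - w x1 / v x1 * v x.
have : forall y, 0 < z y.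
  apply: (@eigvec_gt0 r) => [y||y].
  - by rewrite subr_ge0 -ler_pdivlMr //; apply: hx1.
  - by exists x.
  - rewrite /z; under eq_bigr do rewrite mulrBr mulrCA.
    by rewrite sumrB -mulr_sumr Av Aw; ring.
by move=> /(_ x1); rewrite /z divfK ?subrr ?ltxx // gt_eqF.
Qed.

End perron.

Lemma sum_enum_val {V : nmodType} {X : finType} (F : X -> V) :
  \sum_(i < #|X|) F (enum_val i) = \sum_x F x.
Proof.
rewrite [RHS](reindex_onto enum_val enum_rank) /=; last first.
  by move=> i _; rewrite enum_rankK.
by apply: eq_bigl => i; rewrite enum_valK eqxx.
Qed.

Section perron_pair.
Context {R : realType} {X : finType} (A : X -> X -> R).
Hypothesis A_ge0 : forall x y, 0 <= A x y.
Hypothesis A_irr : connected_graph A.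

Definition perron_pair (r : R) (u v : X -> R) :=
  [/\ forall x, 0 < u x, forall x, 0 < v x,
      forall y, \sum_x u x * A x y = r * u y &
      forall x, \sum_y A x y * v y = r * v x].

Lemma dot_gt0 (u v : X -> R) (x0 : X) :
  (forall x, 0 < u x) -> (forall x, 0 < v x) -> 0 < \sum_x u x * v x.
Proof.
move=> u0 v0; rewrite (bigD1 x0) //=; apply: ltr_pwDl; first exact: mulr_gt0.
by apply: sumr_ge0 => x _; rewrite mulr_ge0 // ltW.
Qed.

Lemma dual_pairing (B : X -> X -> R) (u v : X -> R) :
  \sum_y (\sum_x u x * B x y) * v y = \sum_x u x * \sum_y B x y * v y.
Proof.
under eq_bigr do rewrite mulr_suml; rewrite exchange_big /=.
by apply: eq_bigr => x _; rewrite mulr_sumr; apply: eq_bigr => y _; rewrite mulrA.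
Qed.

Lemma perron_exists (x0 : X) : exists (r : R) (u v : X -> R),
  [/\ perron_pair r u v, \sum_x u x = 1 & \sum_x v x = 1].
Proof.
have [r [v [r0 v0 v1 Av]]] := perron_right A_ge0 A_irr x0.
have [s [u [s0 u0 u1 uA]]] :=
  perron_right (fun x y => A_ge0 y x) (connected_tr A_irr) x0.
have {}uA y : \sum_x u x * A x y = s * u y.
  by rewrite -uA; apply: eq_bigr => x _; rewrite mulrC.
have rs : r = s.
  have := dual_pairing A u v.
  under eq_bigr do rewrite uA -mulrA.
  under [RHS]eq_bigr do rewrite Av mulrCA.
  rewrite -!mulr_sumr => /(mulIf _) -> //.
  by rewrite gt_eqF // dot_gt0.
by exists r, u, v; split => //; split => //; rewrite rs.
Qed.

(** If w A = z w over the complex numbers, then |z| |w| <= |w| A entrywise, and pairing with the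
    positive right eigenvector gives |z| <= r. Two numbers with this domination property bound each
    other, so the choice made in [PF_eigenvalue] is forced. *)
Lemma perron_eigenvalueE (r : R) (u v : X -> R) (x0 : X) :
  perron_pair r u v -> PF_eigenvalue (mx_of A) = r.
Proof.
move=> [u0 v0 uA Av].
have rP : is_PF_eigenvalue (mx_of A) r.
  split.
    apply/eigenvalueP; exists (\row_i u (enum_val i)).
      apply/rowP => j; rewrite !mxE -uA -[RHS]sum_enum_val.
      by apply: eq_bigr => i _; rewrite !mxE.
    apply/eqP => /rowP /(_ (enum_rank x0)); rewrite !mxE enum_rankK => h.
    by have := u0 x0; rewrite h ltxx.
  move=> z /eigenvalueP[w wA w0].
  pose vC (i : 'I_#|X|) := real_complex R (v (enum_val i)).
  have vC0 i : 0 < vC i by rewrite /vC ltcR.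
  have S0 : 0 < \sum_i `|w 0 i| * vC i.
    have [i wi] : exists i, w 0 i != 0.
      apply: contrapT => H; move/eqP: w0; apply; apply/rowP => i; rewrite mxE.
      by apply/eqP; apply: contrapT => /negP h; apply: H; exists i.
    rewrite (bigD1 i) //=; apply: ltr_pwDl.
      by rewrite mulr_gt0 // normr_gt0.
    by apply: sumr_ge0 => j _; rewrite mulr_ge0 // ltW.
  rewrite -(ler_pM2r S0) !mulr_sumr.
  have -> : \sum_i real_complex R r * (`|w 0 i| * vC i) =
     \sum_i \sum_j `|w 0 i| * real_complex R (mx_of A i j) * vC j.
    apply: eq_bigr => i _.
    under eq_bigr do rewrite -mulrA; rewrite -mulr_sumr mulrCA; congr (_ * _).
    rewrite /vC -rmorphM -Av -sum_enum_val rmorph_sum; apply: eq_bigr => j _.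
    by rewrite rmorphM !mxE.
  rewrite exchange_big /=; apply: ler_sum => j _; rewrite -mulr_suml mulrA.
  rewrite ler_pM2r // -normrM.
  have -> : z * w 0 j = \sum_i w 0 i * real_complex R (mx_of A i j).
    move/rowP/(_ j): wA; rewrite !mxE => <-; apply: eq_bigr => i _.
    by rewrite !mxE.
  apply: le_trans (ler_norm_sum _ _ _) _; apply: ler_sum => i _.
  by rewrite normrM [X in _ * X]ger0_norm // mxE lecR.
rewrite /PF_eigenvalue; case: xgetP => [s _ sP|/(_ r)]; last by case/(_ rP).
have le_eig (a b : R) : is_PF_eigenvalue (mx_of A) a -> is_PF_eigenvalue (mx_of A) b ->
    a <= b.
  move=> [/eigenvalueP[w wA w0] _] [_ /(_ (real_complex R a))] h.
  have : `|real_complex R a| <= real_complex R b.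
    apply: h; apply/eigenvalueP; exists (map_mx (real_complex R) w).
      by rewrite -map_mxM wA map_mxZ.
    by rewrite map_mx_eq0.
  move/(le_trans (real_ler_norm _)); rewrite lecR; apply.
  by rewrite realE !(lecR _ 0, lecR 0) -realE num_real.
by apply/eqP; rewrite eq_le !le_eig.
Qed.

(** This is r I - A + J with J all ones. It sends the eigenvectors of sum 1 to all-ones vectors, so
    both are read off its inverse as column and row sums. *)
Definition perron_resolvent (r : R) : 'M[R]_#|X| :=
  mx_of (fun x y => r * (x == y)%:R - A x y + 1).

(** Pairing a left kernel vector [f] with [v] kills the r I - A part and leaves the sum of [f],
    which is therefore 0. Then [f] is a left eigenvector, a multiple of [u], and having sum 0 it is
    null. *)
Lemma perron_resolvent_unit (r : R) (u v : X -> R) :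
  perron_pair r u v -> \sum_x u x = 1 -> \sum_x v x = 1 ->
  perron_resolvent r \in unitmx.
Proof.
move=> [u0 v0 uA Av] u1 v1; rewrite unitmxE unitfE; apply/negP => /det0P[w w0 wB].
pose f x : R := w 0 (enum_rank x).
have fB y : r * f y - \sum_x f x * A x y + \sum_x f x = 0.
  move/rowP/(_ (enum_rank y)): wB; rewrite !mxE => wB; rewrite -[RHS]wB.
  have -> : r * f y = \sum_x f x * (r * (x == y)%:R).
    rewrite (bigD1 y) //= eqxx mulr1 big1 ?addr0 1?mulrC // => x /negPf ->.
    by rewrite !mulr0.
  rewrite -sumrB -big_split /= -sum_enum_val; apply: eq_bigr => i _.
  by rewrite !mxE enum_rankK /f enum_valK mulrDr mulrBr mulr1.
have f0 : \sum_x f x = 0.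
  have : \sum_y (r * f y - \sum_x f x * A x y + \sum_x f x) * v y = 0.
    by rewrite big1 // => y _; rewrite fB mul0r.
  under eq_bigr do rewrite mulrDl mulrBl; rewrite big_split /= sumrB -mulr_sumr v1.
  rewrite dual_pairing; under [X in _ - X]eq_bigr do rewrite Av mulrCA.
  by under [X in X - _]eq_bigr do rewrite -mulrA; rewrite subrr add0r mulr1.
have [k fk] : exists k, forall x, f x = k * u x.
  apply: (eigvec_unique (fun x y => A_ge0 y x) (connected_tr A_irr) (r := r) u0).
    by move=> y; rewrite -uA; apply: eq_bigr => x _; rewrite mulrC.
  move=> y; have := fB y; rewrite f0 addr0 => /eqP; rewrite subr_eq0 => /eqP ->.
  by apply: eq_bigr => x _; rewrite mulrC.
have k0 : k = 0.
  by move: f0; under eq_bigr do rewrite fk; rewrite -mulr_sumr u1 mulr1.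
case/eqP: w0; apply/rowP => i; have := fk (enum_val i).
by rewrite /f enum_valK k0 mul0r mxE.
Qed.

Lemma perron_left_resolvent (r : R) (u v : X -> R) :
  perron_pair r u v -> \sum_x u x = 1 -> \sum_x v x = 1 ->
  forall y, u y = \sum_i invmx (perron_resolvent r) i (enum_rank y).
Proof.
move=> uv u1 v1 y; have B := perron_resolvent_unit uv u1 v1.
have [u0 v0 uA Av] := uv.
have uB : (\row_i u (enum_val i)) *m perron_resolvent r = const_mx 1.
  apply/rowP => j; rewrite !mxE -[RHS]u1 -[RHS]sum_enum_val.
  under eq_bigr do rewrite !mxE mulrDr mulrBr mulr1.
  rewrite big_split /= sumrB [X in _ - X + _](_ : _ = r * u (enum_val j)); last first.
    by rewrite -uA -[RHS]sum_enum_val.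
  rewrite (bigD1 j) //= eqxx mulr1 mulrC [X in _ + X - _]big1 ?addr0 ?subrr ?add0r //.
  by move=> i /negPf ij; rewrite (inj_eq enum_val_inj) ij !mulr0.
have := congr1 (fun w => (w *m invmx (perron_resolvent r)) 0 (enum_rank y)) uB.
rewrite /= mulmxK // !mxE enum_rankK => ->.
by apply: eq_bigr => i _; rewrite mxE mul1r.
Qed.

Lemma perron_right_resolvent (r : R) (u v : X -> R) :
  perron_pair r u v -> \sum_x u x = 1 -> \sum_x v x = 1 ->
  forall x, v x = \sum_j invmx (perron_resolvent r) (enum_rank x) j.
Proof.
move=> uv u1 v1 x; have B := perron_resolvent_unit uv u1 v1.
have [u0 v0 uA Av] := uv.
have Bv : perron_resolvent r *m (\col_i v (enum_val i)) = const_mx 1.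
  apply/colP => j; rewrite !mxE -[RHS]v1 -[RHS]sum_enum_val.
  under eq_bigr do rewrite !mxE mulrDl mulrBl mul1r.
  rewrite big_split /= sumrB [X in _ - X + _](_ : _ = r * v (enum_val j)); last first.
    by rewrite -Av -[RHS]sum_enum_val.
  rewrite (bigD1 j) //= eqxx mulr1 [X in _ + X - _]big1 ?addr0 ?subrr ?add0r //.
  by move=> i /negPf ij; rewrite (inj_eq enum_val_inj) eq_sym ij mulr0 mul0r.
have := congr1 (fun w => (invmx (perron_resolvent r) *m w) (enum_rank x) 0) Bv.
rewrite /= mulKmx // !mxE enum_rankK => ->.
by apply: eq_bigr => i _; rewrite mxE mulr1.
Qed.

End perron_pair.

(** * Calculus *)

Section closure_det.
Context {R : realType} (P : (R -> R) -> Prop).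
Hypothesis P_cst : forall c, P (fun=> c).
Hypothesis P_add : forall f g, P f -> P g -> P (fun t => f t + g t).
Hypothesis P_mul : forall f g, P f -> P g -> P (fun t => f t * g t).

Lemma closure_sum (I : Type) (r : seq I) (Q : pred I) (f : I -> R -> R) :
  (forall i, P (f i)) -> P (fun t => \sum_(i <- r | Q i) f i t).
Proof.
move=> Pf; elim: r => [|i r IH].
  by under eq_fun do rewrite big_nil; exact: P_cst.
under eq_fun do rewrite big_cons.
by case: (Q i) => //; apply: P_add.
Qed.

Lemma closure_prod (I : Type) (r : seq I) (Q : pred I) (f : I -> R -> R) :
  (forall i, P (f i)) -> P (fun t => \prod_(i <- r | Q i) f i t).
Proof.
move=> Pf; elim: r => [|i r IH].
  by under eq_fun do rewrite big_nil; exact: P_cst.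
under eq_fun do rewrite big_cons.
by case: (Q i) => //; apply: P_mul.
Qed.

Lemma closure_det n (M : R -> 'M[R]_n) :
  (forall i j, P (fun t => M t i j)) -> P (fun t => \det (M t)).
Proof.
move=> PM; apply: closure_sum => s; apply: P_mul; first exact: P_cst.
by apply: closure_prod => i; apply: PM.
Qed.

(** Cramer's formula. Keeping [P] abstract lets the same argument serve for continuity and for
    differentiability. *)
Lemma closure_invmx n (M : R -> 'M[R]_n) :
  (forall t, M t \in unitmx) -> (forall i j, P (fun t => M t i j)) ->
  (forall f, (forall t, f t != 0) -> P f -> P (fun t => (f t)^-1)) ->
  forall i j, P (fun t => invmx (M t) i j).
Proof.
move=> Mu PM P_inv i j.
have -> : (fun t => invmx (M t) i j) =
    (fun t => (\det (M t))^-1 * ((-1) ^+ (j + i) * \det (row' j (col' i (M t))))).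
  by apply/funext => t; rewrite /invmx Mu !mxE.
apply: P_mul.
  apply: P_inv => [t|]; last exact: closure_det.
  by have := Mu t; rewrite unitmxE unitfE.
apply: P_mul; first exact: P_cst.
apply: closure_det => k l; rewrite [X in P X](_ : _ = fun t => M t (lift j k) (lift i l)).
  exact: PM.
by apply/funext => t; rewrite !mxE.
Qed.

End closure_det.

Section real_calculus.
Context {R : realType}.
Implicit Types (f df : R -> R) (x l : R).

Lemma is_derive_slope f x l :
  h^-1 * (f (x + h) - f x) @[h --> 0^'] --> l <-> is_derive x 1 f l.
Proof.
have E : (fun h => h^-1 *: ((f \o shift x) (h *: 1) - f x)) =
    (fun h => h^-1 * (f (x + h) - f x)).
  by apply/funext => h; rewrite /= /GRing.scale /= mulr1 (addrC h x).
split => [fl|[d <-]].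
  apply: DeriveDef.
    by rewrite /derivable E; apply/cvg_ex; exists l.
  by rewrite /derive E; apply: cvg_lim.
by move: d; rewrite /derivable /derive E.
Qed.

Lemma mean_value f df x : (forall y : R, is_derive y 1 f (df y)) ->
  exists2 y, `|y| <= `|x| & f x - f 0 = df y * x.
Proof.
move=> fd.
have fc (a b : R) : {within `[a, b], continuous f}.
  apply: continuous_subspaceT => y; apply: differentiable_continuous.
  by apply/derivable1_diffP; have [] := fd y.
have [x0|x0] := leP 0 x.
  have [y + e] := @MVT_segment _ f df 0 x x0 (fun y _ => fd y) (fc _ _).
  rewrite in_itv /= => /andP[y0 yx].
  by exists y; [rewrite !ger0_norm | rewrite e subr0].
have [y + e] := @MVT_segment _ f df x 0 (ltW x0) (fun y _ => fd y) (fc _ _).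
rewrite in_itv /= => /andP[xy y0].
exists y; first by rewrite !ler0_norm // ?lerN2 // ltW.
by apply: oppr_inj; rewrite opprB e sub0r mulrN.
Qed.

(** Differentiability of [df] at the single point 0 is enough: after subtracting the expected
    quadratic polynomial, the derivative of the remainder [F] at y is o(y), and the mean value
    theorem integrates this to o(h^2). *)
Lemma taylor_peano2 f df (c : R) : (forall y : R, is_derive y 1 f (df y)) ->
  is_derive (0 : R) 1 df c ->
  (h ^+ 2)^-1 * (f h - f 0 - df 0 * h) @[h --> 0^'] --> c / 2.
Proof.
move=> fd /is_derive_slope dfc; apply/cvgrPdist_le => e e0.
have /cvgrPdist_le /(_ e e0) := dfc.
rewrite /prop_near1 /within /= => /nbhs_ballP[d d0 hd].
apply/nbhs_ballP; exists d => // h0; rewrite /ball /= sub0r normrN; set h : R := h0 => hlt hn0.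
pose F t := f t - df 0 * t - c / 2 * t ^+ 2.
have Fd (y : R) : is_derive y 1 F (df y - df 0 - c * y).
  have := fd y => fdy; rewrite /F; apply: is_derive_eq.
  by rewrite /GRing.scale /= ; field.
have [y yh E] := mean_value h Fd.
have -> : c / 2 - (h ^+ 2)^-1 * (f h - f 0 - df 0 * h) = - ((h ^+ 2)^-1 * (F h - F 0)).
  by rewrite /F; field.
rewrite normrN E normrM normfV normrX ler_pdivrMl ?exprn_gt0 ?normr_gt0 //.
have key : `|df y - df 0 - c * y| <= e * `|h|.
  (* The mean value point may be 0 itself, where the slope estimate on the punctured neighbourhood
     says nothing. *)
  have [->|y0] := eqVneq y 0.
    by rewrite mulr0 subrr subr0 normr0 mulr_ge0 // ltW.
  apply: (@le_trans _ _ (e * `|y|)); last by rewrite ler_pM2l.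
  have := hd y; rewrite /ball /= sub0r normrN add0r => /(_ (le_lt_trans yh hlt) y0).
  have -> : df y - df 0 - c * y = - (c - y^-1 * (df y - df 0)) * y by field.
  by rewrite normrM normrN ler_pM2r // normr_gt0.
rewrite normrM [leRHS](_ : _ = e * `|h| * `|h|); last by ring.
by rewrite ler_pM2r // normr_gt0.
Qed.
End real_calculus.

(** * Differentiability of the Perron-Frobenius eigenvalue *)

Definition exp_tilt {R : realType} {X : finType} (W g : X -> X -> R) (theta : R)
  (x y : X) : R := W x y * expR (theta * g x y).

Definition pf {R : realType} {X : finType} (W g : X -> X -> R) (theta : R) : R :=
  PF_eigenvalue (mx_of (exp_tilt W g theta)).

Definition pf_left {R : realType} {X : finType} (W g : X -> X -> R) (theta : R)
    (y : X) : R :=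
  \sum_i invmx (perron_resolvent (exp_tilt W g theta) (pf W g theta)) i (enum_rank y).

Definition pf_right {R : realType} {X : finType} (W g : X -> X -> R) (theta : R)
    (x : X) : R :=
  \sum_j invmx (perron_resolvent (exp_tilt W g theta) (pf W g theta)) (enum_rank x) j.

(** The first-order perturbation formula u A' v / (u v), with A' the entrywise derivative of the
    tilted matrix. *)
Definition dpf {R : realType} {X : finType} (W g : X -> X -> R) (theta : R) : R :=
  (\sum_x \sum_y pf_left W g theta x * (exp_tilt W g theta x y * g x y)
      * pf_right W g theta y) /
  \sum_x pf_left W g theta x * pf_right W g theta x.

Section tilted_family.
Context {R : realType} {X : finType} (W g : X -> X -> R) (x0 : X).
Hypothesis W_ge0 : forall x y, 0 <= W x y.
Hypothesis W_irr : connected_graph W.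
Hypothesis W_neq0 : exists x y, 0 < W x y.

Local Notation A := (exp_tilt W g).
Local Notation lam := (pf W g).
Local Notation u := (pf_left W g).
Local Notation v := (pf_right W g).

Lemma exp_tilt_ge0 theta x y : 0 <= A theta x y.
Proof. by rewrite mulr_ge0 // expR_ge0. Qed.

Lemma exp_tilt_gt0 theta x y : (0 < A theta x y) = (0 < W x y).
Proof. by rewrite /A /exp_tilt pmulr_lgt0 // expR_gt0. Qed.

Lemma exp_tilt_connected theta : connected_graph (A theta).
Proof.
move=> S S0 cl; apply: W_irr => // x y yS Wxy.
by apply: (cl _ y) => //; rewrite exp_tilt_gt0.
Qed.

Lemma pf_pair theta : [/\ perron_pair (A theta) (lam theta) (u theta) (v theta),
  \sum_x u theta x = 1 & \sum_x v theta x = 1].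
Proof.
have [r [u' [v' [uv u1 v1]]]] :=
  perron_exists (exp_tilt_ge0 theta) (@exp_tilt_connected theta) x0.
have r_lam : lam theta = r by apply: (perron_eigenvalueE (exp_tilt_ge0 theta) x0 uv).
have A0 := exp_tilt_ge0 theta; have Ac := @exp_tilt_connected theta.
have -> : u theta = u'.
  apply/funext => y.
  by rewrite /u /pf_left -/(lam _) r_lam (perron_left_resolvent A0 Ac uv u1 v1).
have -> : v theta = v'.
  apply/funext => y.
  by rewrite /v /pf_right -/(lam _) r_lam (perron_right_resolvent A0 Ac uv u1 v1).
by rewrite r_lam.
Qed.

Lemma pf_left_gt0 theta x : 0 < u theta x.
Proof. by have [[]] := pf_pair theta. Qed.

Lemma pf_right_gt0 theta x : 0 < v theta x.
Proof. by have [[]] := pf_pair theta. Qed.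

Lemma pf_leftE theta y : \sum_x u theta x * A theta x y = lam theta * u theta y.
Proof. by have [[]] := pf_pair theta. Qed.

Lemma pf_rightE theta x : \sum_y A theta x y * v theta y = lam theta * v theta x.
Proof. by have [[]] := pf_pair theta. Qed.

Lemma pf_right_sum1 theta : \sum_x v theta x = 1.
Proof. by have [] := pf_pair theta. Qed.

Lemma pf_left_sum1 theta : \sum_x u theta x = 1.
Proof. by have [] := pf_pair theta. Qed.

Lemma pf_dot_gt0 theta theta' : 0 < \sum_x u theta x * v theta' x.
Proof. by apply: dot_gt0 => // x; [apply: pf_left_gt0|apply: pf_right_gt0]. Qed.

Lemma pf_gt0 theta : 0 < lam theta.
Proof.
have [x [y Wxy]] := W_neq0.
have : 0 < lam theta * v theta x.
  rewrite -pf_rightE (bigD1 y) //=; apply: ltr_pwDl.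
    by rewrite mulr_gt0 ?exp_tilt_gt0 // pf_right_gt0.
  by apply: sumr_ge0 => z _; rewrite mulr_ge0 ?exp_tilt_ge0 // ltW ?pf_right_gt0.
by rewrite pmulr_lgt0 // pf_right_gt0.
Qed.

(* Both sides are bilinear forms in the left vector at [theta] and the right
   vector at [theta'], so no perturbation of eigenvectors enters. *)
Lemma pf_increment theta theta' :
  (lam theta' - lam theta) * (\sum_x u theta x * v theta' x) =
  \sum_x \sum_y u theta x * (A theta' x y - A theta x y) * v theta' y.
Proof.
transitivity (\sum_x u theta x * (\sum_y A theta' x y * v theta' y)
   - \sum_y (\sum_x u theta x * A theta x y) * v theta' y).
  rewrite mulrBl; congr (_ - _); rewrite mulr_sumr; apply: eq_bigr => x _.
    by rewrite pf_rightE mulrCA.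
  by rewrite pf_leftE mulrA.
rewrite dual_pairing -sumrB; apply: eq_bigr => x _.
rewrite -mulrBr -sumrB mulr_sumr; apply: eq_bigr => y _; ring.
Qed.

(** The tilted matrices compare entrywise up to the exponential factor, and pairing with the left
    vector at [theta] and the right vector at [theta'] passes this to the eigenvalues. It is a
    Lipschitz bound on the logarithm of the eigenvalue that uses no regularity of eigenvectors. *)
Lemma pf_le_exp theta theta' :
  lam theta' <= expR (`|theta' - theta| * \sum_x \sum_y `|g x y|) * lam theta.
Proof.
set G := \sum_x _; set E := expR _.
have AE x y : A theta' x y <= E * A theta x y.
  rewrite /A /exp_tilt mulrCA ler_wpM2l // -expRD ler_expR -lerBlDr -mulrBl.
  apply: le_trans (ler_norm _) _; rewrite normrM ler_wpM2l //.
  rewrite /G (bigD1 x) //= (bigD1 y) //= -addrA lerDl addr_ge0 // sumr_ge0 // => z _.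
  exact: sumr_ge0.
rewrite -(ler_pM2r (pf_dot_gt0 theta theta')).
have -> : E * lam theta * (\sum_x u theta x * v theta' x) =
    \sum_y (\sum_x u theta x * (E * A theta x y)) * v theta' y.
  rewrite mulr_sumr; apply: eq_bigr => y _; rewrite -!mulrA [lam _ * _]mulrA.
  rewrite -pf_leftE mulrA mulr_sumr; congr (_ * _); apply: eq_bigr => x _; ring.
rewrite mulr_sumr.
have -> : \sum_x lam theta' * (u theta x * v theta' x) =
    \sum_y (\sum_x u theta x * A theta' x y) * v theta' y.
  by rewrite dual_pairing; apply: eq_bigr => x _; rewrite pf_rightE mulrCA.
apply: ler_sum => y _; rewrite ler_pM2r ?pf_right_gt0 //.
by apply: ler_sum => x _; rewrite ler_pM2l ?pf_left_gt0.
Qed.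

Lemma pf_continuous : continuous lam.
Proof.
move=> theta; pose G := \sum_x \sum_y `|g x y|.
have Ec (s : R) : expR (s * (`|theta' - theta| * G)) @[theta' --> theta] --> (1 : R).
  rewrite -[X in _ --> X]expR0.
  apply: (@cvg_comp _ _ _ (fun t => s * (`|t - theta| * G)) expR _ (nbhs (0 : R)));
    last exact: continuous_expR.
  change (s * (`|t - theta| * G) @[t --> theta] --> (0 : R)).
  rewrite -[X in _ --> X](mulr0 s); apply: cvgM; first exact: cvg_cst.
  rewrite -[X in _ --> X](mul0r G); apply: cvgM; last exact: cvg_cst.
  rewrite -[X in _ --> X](normr0 R); apply: cvg_norm.
  by rewrite -[X in _ --> X](subrr theta); apply: cvgB; [exact: cvg_id|exact: cvg_cst].
apply: (@squeeze_cvgr _ _ _ _ (fun t => expR (- 1 * (`|t - theta| * G)) * lam theta)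
   (fun t => expR (1 * (`|t - theta| * G)) * lam theta)).
- near=> t; apply/andP; split; last by rewrite mul1r; apply: pf_le_exp.
  rewrite mulN1r expRN mulrC ler_pdivrMr ?expR_gt0 // mulrC distrC.
  exact: pf_le_exp.
- by rewrite -[X in _ --> X]mul1r; apply: cvgM; [exact: Ec|exact: cvg_cst].
- by rewrite -[X in _ --> X]mul1r; apply: cvgM; [exact: Ec|exact: cvg_cst].
Unshelve. all: by end_near. Qed.

Lemma exp_tilt_is_derive theta x y :
  is_derive theta (1 : R) (fun t => A t x y) (A theta x y * g x y).
Proof.
rewrite /A /exp_tilt; apply: is_derive_eq; rewrite /GRing.scale /=; ring.
Qed.

Lemma resolvent_unit theta : perron_resolvent (A theta) (lam theta) \in unitmx.
Proof.
have [uv u1 v1] := pf_pair theta.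
by apply: perron_resolvent_unit uv u1 v1;
  [apply: exp_tilt_ge0 | apply: exp_tilt_connected].
Qed.

Section closure_eigenvectors.
Variable P : (R -> R) -> Prop.
Hypothesis P_cst : forall c, P (fun=> c).
Hypothesis P_add : forall f h, P f -> P h -> P (fun t => f t + h t).
Hypothesis P_mul : forall f h, P f -> P h -> P (fun t => f t * h t).
Hypothesis P_inv : forall f, (forall t, f t != 0) -> P f -> P (fun t => (f t)^-1).
Hypothesis P_A : forall x y, P (fun t => A t x y).
Hypothesis P_lam : P lam.

(** Whatever regularity [P] the eigenvalue has is inherited by the eigenvectors. It is applied with
    [P] continuity, and again with [P] differentiability once [pf_is_derive] is available. *)
Lemma closure_resolvent i j :
  P (fun t => invmx (perron_resolvent (A t) (lam t)) i j).
Proof.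
apply: closure_invmx => //; first exact: resolvent_unit.
move=> k l; rewrite [X in P X](_ : _ = fun t => lam t * (enum_val k == enum_val l)%:R
  + (-1) * A t (enum_val k) (enum_val l) + 1).
  by do !apply: P_add => //; apply: P_mul.
by apply/funext => t; rewrite !mxE mulN1r.
Qed.

Lemma closure_pf_left x : P (fun t => u t x).
Proof. by apply: closure_sum => // i; apply: closure_resolvent. Qed.

Lemma closure_pf_right x : P (fun t => v t x).
Proof. by apply: closure_sum => // i; apply: closure_resolvent. Qed.

Lemma closure_dpf : P (dpf W g).
Proof.
have Pu := closure_pf_left; have Pv := closure_pf_right.
apply: P_mul.
  apply: closure_sum => // x; apply: closure_sum => // y.
  by do !apply: P_mul => //.
apply: P_inv => [t|]; first by rewrite gt_eqF // pf_dot_gt0.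
by apply: closure_sum => // x; apply: P_mul.
Qed.

End closure_eigenvectors.

Lemma pf_left_continuous x : continuous (fun t => u t x).
Proof.
apply: (@closure_pf_left (fun f => continuous f)).
- by move=> c; exact: cst_continuous.
- by move=> f h cf ch t; apply: cvgD; [exact: cf|exact: ch].
- by move=> f h cf ch t; apply: cvgM; [exact: cf|exact: ch].
- by move=> f f0 cf t; apply: cvgV; [exact: f0|exact: cf].
- move=> a b t; apply: differentiable_continuous; apply/derivable1_diffP.
  by have [] := exp_tilt_is_derive t a b.
- exact: pf_continuous.
Qed.

Lemma pf_right_continuous x : continuous (fun t => v t x).
Proof.
apply: (@closure_pf_right (fun f => continuous f)).
- by move=> c; exact: cst_continuous.
- by move=> f h cf ch t; apply: cvgD; [exact: cf|exact: ch].
- by move=> f h cf ch t; apply: cvgM; [exact: cf|exact: ch].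
- by move=> f f0 cf t; apply: cvgV; [exact: f0|exact: cf].
- move=> a b t; apply: differentiable_continuous; apply/derivable1_diffP.
  by have [] := exp_tilt_is_derive t a b.
- exact: pf_continuous.
Qed.

(** Divided by [h], [pf_increment] contains difference quotients of the matrix entries only; the
    right eigenvector enters through its values at [theta + h], so its continuity suffices. *)
Lemma pf_is_derive (theta : R) : is_derive theta (1 : R) lam (dpf W g theta).
Proof.
apply/is_derive_slope.
have shiftc (f : R -> R) : continuous f -> f (theta + h) @[h --> (0 : R)^'] --> f theta.
  move=> cf; apply: cvg_within_filter.
  apply: (@cvg_comp _ _ _ (fun h => theta + h) f _ (nbhs theta)); last exact: cf.
  change (theta + h @[h --> (0 : R)] --> theta).
  rewrite -[X in _ --> X]addr0; apply: cvgD; [exact: cvg_cst|exact: cvg_id].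
have vc y : v (theta + h) y @[h --> (0 : R)^'] --> pf_right W g theta y.
  exact: (shiftc (fun t => v t y) (@pf_right_continuous y)).
rewrite (_ : (fun h => _) = fun h =>
  (\sum_x \sum_y u theta x * (h^-1 * (A (theta + h) x y - A theta x y)) * v (theta + h) y)
  / \sum_x u theta x * v (theta + h) x); last first.
  apply/funext => h; apply: (mulIf (lt0r_neq0 (pf_dot_gt0 theta (theta + h)))).
  rewrite divfK ?gt_eqF ?pf_dot_gt0 // -mulrA pf_increment mulr_sumr.
  by apply: eq_bigr => x _; rewrite mulr_sumr; apply: eq_bigr => y _; ring.
apply: cvgM.
  apply: cvg_bigsum => x; apply: cvg_bigsum => y.
  apply: cvgM; last exact: vc.
  apply: cvgM; first exact: cvg_cst.
  exact: (iffRL (is_derive_slope (fun t => A t x y) theta _) (exp_tilt_is_derive theta x y)).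
apply: cvgV; first by rewrite gt_eqF // pf_dot_gt0.
apply: cvg_bigsum => x; apply: cvgM; first exact: cvg_cst.
exact: vc.
Qed.

Lemma derivable_closure : let P := fun f : R -> R => forall t, derivable f t 1 in
  [/\ forall c, P (fun=> c),
      forall f h, P f -> P h -> P (fun t => f t + h t),
      forall f h, P f -> P h -> P (fun t => f t * h t) &
      forall f, (forall t, f t != 0) -> P f -> P (fun t => (f t)^-1)].
Proof.
split.
- by move=> c t; exact: derivable_cst.
- by move=> f h df dh t; apply: derivableD; [exact: df|exact: dh].
- by move=> f h df dh t; apply: derivableM; [exact: df|exact: dh].
- by move=> f f0 df t; apply: derivableV; [exact: f0|exact: df].
Qed.

Lemma pf_right_derivable x (theta : R) : derivable (fun t => v t x) theta 1.
Proof.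
move: theta; have [Pc PD PM PV] := derivable_closure.
apply: (closure_pf_right Pc PD PM PV) => [a b t|t].
  by have [] := exp_tilt_is_derive t a b.
by have [] := pf_is_derive t.
Qed.

Lemma dpf_derivable (theta : R) : derivable (dpf W g) theta 1.
Proof.
move: theta; have [Pc PD PM PV] := derivable_closure.
apply: (closure_dpf Pc PD PM PV) => [a b t|t].
  by have [] := exp_tilt_is_derive t a b.
by have [] := pf_is_derive t.
Qed.

End tilted_family.

(** * Second derivative at 0 as a stationary variance, and its positivity *)

Lemma is_derive_bigsum {R : realType} (I : finType) (f : I -> R -> R) (df : I -> R)
    (x : R) : (forall i, is_derive x 1 (f i) (df i)) ->
  is_derive x 1 (fun t => \sum_i f i t) (\sum_i df i).
Proof.
move=> fd; apply/is_derive_slope.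
rewrite (_ : (fun h => _) = fun h => \sum_i h^-1 * (f i (x + h) - f i x)); last first.
  by apply/funext => h; rewrite -sumrB mulr_sumr.
apply: cvg_bigsum => i; exact: (iffRL (is_derive_slope (f i) x (df i)) (fd i)).
Qed.

(* With [q = l pi], [pi] is stationary and [q] solves the Poisson equation of [g];
   the sum is the stationary variance of [g] plus a (time-reversed) coboundary. *)
Lemma variance_identity {R : realType} {X : finType} (W g : X -> X -> R)
    (pi q l : X -> R) (m : R) :
  (forall y, \sum_x W x y = 1) -> (forall x, \sum_y W x y * pi y = pi x) ->
  \sum_x pi x = 1 -> \sum_x q x = 0 -> (forall y, q y = l y * pi y) ->
  m = \sum_x \sum_y W x y * g x y * pi y ->
  (forall x, \sum_y (W x y * g x y * pi y + W x y * q y) = m * pi x + q x) ->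
  \sum_x \sum_y W x y * pi y * (g x y - m + l y - l x) ^+ 2 =
  2 * (\sum_x \sum_y (W x y * (g x y ^+ 2 / 2) * pi y + W x y * g x y * q y)) - m ^+ 2.
Proof.
move=> W_sum1 Wpi pi1 q0 qE mE poisson.
have W1 (f : X -> R) : \sum_x \sum_y W x y * f y = \sum_y f y.
  rewrite exchange_big; apply: eq_bigr => y _ /=.
  by rewrite -mulr_suml W_sum1 mul1r.
(* Expand the square and group: terms depending on [y] alone collapse by the column sums of [W],
   terms carrying a factor [l x] by stationarity and the Poisson equation. *)
transitivity (2 * (\sum_x \sum_y (W x y * (g x y ^+ 2 / 2) * pi y + W x y * g x y * q y))
   + \sum_x \sum_y W x y * (pi y * m ^+ 2 + q y * l y - 2 * m * q y)
   + (-2 * m) * (\sum_x \sum_y W x y * g x y * pi y)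
   + \sum_x (l x ^+ 2 * (\sum_y W x y * pi y) + 2 * l x * (m * (\sum_y W x y * pi y)
        - \sum_y (W x y * g x y * pi y + W x y * q y)))).
  rewrite !mulr_sumr -!big_split; apply: eq_bigr => x _ /=.
  rewrite !mulr_sumr -sumrB mulr_sumr -!big_split; apply: eq_bigr => y _ /=.
  by rewrite qE; field.
rewrite W1 -mE.
under [X in _ + X = _]eq_bigr do rewrite Wpi poisson.
rewrite [X in _ + X = _](_ : _ = - \sum_x q x * l x); last first.
  by rewrite -sumrN; apply: eq_bigr => x _; rewrite qE; ring.
rewrite [X in _ + X + _ + _](_ : _ = m ^+ 2 + \sum_x q x * l x); last first.
  by rewrite sumrB big_split /= -mulr_suml pi1 mul1r -mulr_sumr q0 mulr0 subr0.
ring.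
Qed.

Lemma transition_neq0 {R : realType} {X : finType} (W : X -> X -> R) (x0 : X) :
  is_transition W -> exists x y, 0 < W x y.
Proof.
move=> /(_ x0)[W0 W1]; apply: contrapT => H; have /eqP := W1.
rewrite big1 ?(eq_sym 0) ?oner_eq0 // => x _.
apply/eqP; rewrite eq_le W0 andbT leNgt; apply/negP => h.
by apply: H; exists x, x0.
Qed.

Section variance.
Context {R : realType} {X : finType} (W g : X -> X -> R) (x0 : X).
Hypothesis W_stoch : is_transition W.
Hypothesis W_irr : connected_graph W.

Let W_ge0 x y : 0 <= W x y.
Proof. by have [/(_ x)] := W_stoch y. Qed.

Let W_sum1 y : \sum_x W x y = 1.
Proof. by have [] := W_stoch y. Qed.

Local Notation lam := (pf W g).
Local Notation v := (pf_right W g).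
Local Notation m := (dpf W g 0).

Lemma exp_tilt0 x y : exp_tilt W g 0 x y = W x y.
Proof. by rewrite /exp_tilt mul0r expR0 mulr1. Qed.

Lemma pf0 : lam 0 = 1.
Proof.
have E := pf_rightE g x0 W_ge0 W_irr 0.
have <- : \sum_x lam 0 * v 0 x = 1.
  under eq_bigr do rewrite -E; rewrite exchange_big /=.
  rewrite -(pf_right_sum1 g x0 W_ge0 W_irr 0); apply: eq_bigr => y _.
  by rewrite -mulr_suml; under eq_bigr do rewrite exp_tilt0; rewrite W_sum1 mul1r.
by rewrite -mulr_sumr (pf_right_sum1 g x0 W_ge0 W_irr 0) mulr1.
Qed.

(* The left eigenvector at [0] is constant. *)
Lemma pf_increment0 h : lam h - 1 = \sum_x \sum_y W x y * (expR (h * g x y) - 1) * v h y.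
Proof.
have v1 := pf_right_sum1 g x0 W_ge0 W_irr h.
have -> : lam h = \sum_x \sum_y exp_tilt W g h x y * v h y.
  under eq_bigr do rewrite (pf_rightE g x0 W_ge0 W_irr h).
  by rewrite -mulr_sumr v1 mulr1.
rewrite [X in _ - X = _](_ : 1 = \sum_x \sum_y W x y * v h y); last first.
  by rewrite exchange_big /= -v1; apply: eq_bigr => y _; rewrite -mulr_suml W_sum1 mul1r.
rewrite -sumrB; apply: eq_bigr => x _; rewrite -sumrB; apply: eq_bigr => y _.
by rewrite /exp_tilt; ring.
Qed.

Let q y : R := 'D_1 (fun t => v t y) 0.

Lemma pf_right_derive y : is_derive (0 : R) 1 (fun t => v t y) (q y).
Proof. by apply: derivableP; exact: pf_right_derivable. Qed.

Lemma expM_derive (c t : R) : is_derive t 1 (fun s => expR (s * c)) (expR (t * c) * c).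
Proof. by apply: is_derive_eq; rewrite /GRing.scale /=; ring. Qed.

Let shift0 (f : R -> R) : {for 0, continuous f} -> f h @[h --> (0 : R)^'] --> f 0.
Proof. by move=> cf; apply: cvg_within_filter; exact: cf. Qed.

Let v_cont0 y : v h y @[h --> (0 : R)^'] --> v 0 y.
Proof.
apply: (shift0 (f := fun t => v t y)).
exact: pf_right_continuous.
Qed.

Lemma dpf0E : m = \sum_x \sum_y W x y * g x y * v 0 y.
Proof.
have := iffRL (is_derive_slope _ _ _) (pf_is_derive g x0 W_ge0 W_irr 0).
rewrite (_ : (fun h => _) = fun h =>
   \sum_x \sum_y W x y * (h^-1 * (expR (h * g x y) - 1)) * v h y); last first.
  apply/funext => h; rewrite add0r pf0 pf_increment0 mulr_sumr; apply: eq_bigr => x _.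
  by rewrite mulr_sumr; apply: eq_bigr => y _; ring.
move/cvg_unique; apply => //.
apply: cvg_bigsum => x; apply: cvg_bigsum => y; apply: cvgM; last exact: v_cont0.
apply: cvgM; first exact: cvg_cst.
have := iffRL (is_derive_slope _ _ _) (expM_derive (g x y) 0).
by under eq_fun do rewrite add0r mul0r expR0; rewrite mul0r expR0 mul1r.
Qed.

(** The second-order Taylor quotient is computed a second time from [pf_increment0]. There the
    factor [expR (h * g x y) - 1] already vanishes to first order, so only the first derivative [q]
    of the right eigenvector appears. *)
Lemma ddpf0E : ('D_1 (dpf W g) 0) / 2 =
  \sum_x \sum_y (W x y * (g x y ^+ 2 / 2) * v 0 y + W x y * g x y * q y).
Proof.
have dm : is_derive (0 : R) 1 (dpf W g) ('D_1 (dpf W g) 0).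
  by apply: derivableP; exact: dpf_derivable.
have := taylor_peano2 (pf_is_derive g x0 W_ge0 W_irr) dm.
rewrite pf0 dpf0E => tay; have := cvg_unique _ tay; apply => //.
have : \sum_x \sum_y (W x y * ((h ^+ 2)^-1 * (expR (h * g x y) - 1 - g x y * h)) * v h y
   + W x y * g x y * (h^-1 * (v h y - v 0 y))) @[h --> (0 : R)^'] -->
   \sum_x \sum_y (W x y * (g x y ^+ 2 / 2) * v 0 y + W x y * g x y * q y).
  apply: cvg_bigsum => x; apply: cvg_bigsum => y; apply: cvgD.
    apply: cvgM; last exact: v_cont0.
    apply: cvgM; first exact: cvg_cst.
    have d2 : is_derive (0 : R) 1 (fun s => expR (s * g x y) * g x y) (g x y ^+ 2).
      by apply: is_derive_eq; rewrite /GRing.scale /= mul0r expR0; ring.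
    have := taylor_peano2 (expM_derive (g x y)) d2.
    by under eq_fun do rewrite mul0r expR0 mul1r.
  apply: cvgM; first exact: cvg_cst.
  have D : h^-1 * (v (0 + h) y - v 0 y) @[h --> (0 : R)^'] --> q y.
    exact: (iffRL (is_derive_slope (fun t => v t y) 0 (q y)) (pf_right_derive y)).
  have E : (fun h : R => h^-1 * (v (0 + h) y - v 0 y)) =
      (fun h => h^-1 * (v h y - v 0 y)) by apply/funext => h; rewrite add0r.
  by rewrite E in D.
apply: cvg_trans; apply: near_eq_cvg; near=> h.
have h0 : h != 0 by near: h; exact: nbhs_dnbhs_neq.
rewrite pf_increment0 [X in _ - X]mulr_suml -sumrB mulr_sumr.
apply: eq_bigr => x _; rewrite mulr_suml -sumrB mulr_sumr; apply: eq_bigr => y _.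
move: (v h y) => a; move: (v _ y) => b.
move: (expR _) => c; move: (W x y) (g x y) => d e; by field.
Unshelve. all: by end_near. Qed.

Lemma derive_right_sum0 : \sum_y q y = 0.
Proof.
have [_ <-] : is_derive (0 : R) 1 (fun t => \sum_y v t y) (\sum_y q y).
  exact/is_derive_bigsum/pf_right_derive.
have -> : (fun t => \sum_y v t y) = (fun=> 1 : R).
  by apply/funext => t; exact: pf_right_sum1.
exact: derive_cst.
Qed.

(** The eigenvector equation differentiated at 0, which is the Poisson equation required by
    [variance_identity]. *)
Lemma derive_rightE x :
  \sum_y (W x y * g x y * v 0 y + W x y * q y) = m * v 0 x + q x.
Proof.
have [_ <-] : is_derive (0 : R) 1 (fun t => \sum_y exp_tilt W g t x y * v t y)
    (\sum_y (W x y * g x y * v 0 y + W x y * q y)).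
  apply: is_derive_bigsum => y; have := pf_right_derive y => dv.
  have := exp_tilt_is_derive W g 0 x y => dA.
  apply: is_derive_eq; rewrite /GRing.scale /= exp_tilt0.
  move: (v _ y) (q y) (W x y) (g x y) => a b c d; ring.
have -> : (fun t => \sum_y exp_tilt W g t x y * v t y) = (fun t => lam t * v t x).
  by apply/funext => t; exact: pf_rightE.
have := pf_is_derive g x0 W_ge0 W_irr 0 => dl.
have := pf_right_derive x => dv.
rewrite derive_val /GRing.scale /= pf0.
move: (v _ x) (q x) (dpf _ _ _) => a b c; ring.
Qed.

(** The gap is a sum of nonnegative terms; if it were 0, every term on an edge would vanish, making
    [g] the constant [m] plus the coboundary of [l = q / v 0]. *)
Lemma variance_gt0 :
  ~ (exists (c : R) (l : X -> R), forall x y, 0 < W x y -> g x y = c + l x - l y) ->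
  m ^+ 2 < 'D_1 (dpf W g) 0.
Proof.
move=> ncob.
have v0 y : 0 < v 0 y by exact: pf_right_gt0.
have [l qE] : exists l : X -> R, forall y, q y = l y * v 0 y.
  by exists (fun y => q y / v 0 y) => y; rewrite divfK // gt_eqF.
pose F x y := W x y * v 0 y * (g x y - m + l y - l x) ^+ 2.
have F0 x y : 0 <= F x y.
  by apply: mulr_ge0; [apply: mulr_ge0 => //; exact: ltW | exact: sqr_ge0].
have FE : \sum_x \sum_y F x y = 'D_1 (dpf W g) 0 - m ^+ 2.
  have -> : 'D_1 (dpf W g) 0 = 2 * ('D_1 (dpf W g) 0 / 2).
    by rewrite mulrCA divff ?mulr1 // pnatr_eq0.
  rewrite ddpf0E; apply: variance_identity.
  - exact: W_sum1.
  - move=> x; have := pf_rightE g x0 W_ge0 W_irr 0 x; rewrite pf0 mul1r => <-.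
    by apply: eq_bigr => y _; rewrite exp_tilt0.
  - exact: pf_right_sum1.
  - exact: derive_right_sum0.
  - exact: qE.
  - exact: dpf0E.
  - exact: derive_rightE.
have S0 : 0 <= \sum_x \sum_y F x y.
  by apply: sumr_ge0 => x _; apply: sumr_ge0 => y _; exact: F0.
rewrite -subr_gt0 -FE lt0r S0 andbT; apply/eqP => SF.
apply: ncob; exists m, l => x y Wxy.
have Fx : \sum_y F x y = 0.
  by apply: (psumr_eq0P _ SF) => // z _; apply: sumr_ge0 => w _; exact: F0.
have : F x y = 0 by apply: (psumr_eq0P _ Fx) => // z _; exact: F0.
rewrite /F => /eqP; rewrite mulf_eq0 gt_eqF ?mulr_gt0 //= sqrf_eq0.
rewrite -addrA addr_eq0 opprB subr_eq => /eqP ->.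
by rewrite addrC addrA addrAC.
Qed.

End variance.

(** * Hypothesis testing in the moderate deviation regime *)

Section beta_bounds.
Context {R : realType} {Y : finType}.

Lemma beta_le (eps : R) (P1 P0 T : Y -> R) : (forall y, 0 <= P0 y) ->
  is_test T -> \sum_y P1 y * T y <= eps -> beta eps P1 P0 <= \sum_y P0 y * (1 - T y).
Proof.
move=> P00 testT le_eps; apply: ge_inf; last by exists T.
exists 0 => _ [S [testS _ ->]]; apply: sumr_ge0 => y _.
by rewrite mulr_ge0 // subr_ge0; case/andP: (testS y).
Qed.

Lemma beta_ge (eps b : R) (P1 P0 : Y -> R) : 0 <= eps ->
  (forall T, is_test T -> \sum_y P1 y * T y <= eps -> b <= \sum_y P0 y * (1 - T y)) ->
  b <= beta eps P1 P0.
Proof.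
move=> eps0 H; apply: lb_le_inf => [|_ [T [testT le_eps ->]]]; last exact: H.
exists (\sum_y P0 y * (1 - 0)), (fun=> 0); split => //.
  by move=> y; rewrite lexx ler01.
by rewrite big1 // => y _; rewrite mulr0.
Qed.

Variables (Q0 Q1 ell : Y -> R).
Hypothesis Q0_ge0 : forall y, 0 <= Q0 y.
Hypothesis Q0_sum1 : \sum_y Q0 y = 1.
Hypothesis Q1E : forall y, Q1 y = Q0 y * expR (ell y).

Let Q1_ge0 y : 0 <= Q1 y.
Proof. by rewrite Q1E mulr_ge0 // expR_ge0. Qed.

Lemma sum_below_threshold_le (k : R) : \sum_(y | ell y <= k) Q1 y <= expR k.
Proof.
rewrite -[leRHS]mul1r -Q0_sum1 mulr_suml big_mkcond; apply: ler_sum => y _.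
case: ifPn => [h|_]; last by rewrite mulr_ge0 // expR_ge0.
by rewrite Q1E ler_wpM2l // ler_expR.
Qed.

Let test_bool (p : pred Y) : is_test (fun y => (p y)%:R : R).
Proof. by move=> y; case: (p y); rewrite ?lexx ?ler01. Qed.

Lemma beta10_le (k : R) : beta (expR k) Q1 Q0 <= \sum_(y | k < ell y) Q0 y.
Proof.
apply: le_trans (beta_le Q0_ge0 (test_bool (fun y => ell y <= k)) _) _.
- apply: le_trans (sum_below_threshold_le k); rewrite [leRHS]big_mkcond; apply: ler_sum => y _.
  by rewrite /=; case: ifP => _; rewrite ?mulr1 ?mulr0.
- rewrite [leRHS]big_mkcond; apply: ler_sum => y _; rewrite ltNge.
  by rewrite /=; case: (ell y <= k); rewrite /= ?subrr ?subr0 ?mulr0 ?mulr1.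
Qed.

(** Where [k' < ell], [Q0] is at most [expR (- k') * Q1], so the part of [Q0] accepted by [T] is
    charged to the level. The slack [k' - k] makes this charge small. *)
Lemma beta10_ge (k k' : R) :
  \sum_(y | k' < ell y) Q0 y - expR (k - k') <= beta (expR k) Q1 Q0.
Proof.
apply: beta_ge => [|T testT le_k]; first exact: expR_ge0.
rewrite lerBlDr.
apply: (@le_trans _ _ (\sum_y Q0 y * (1 - T y) + expR (- k') * \sum_y Q1 y * T y)).
  rewrite big_mkcond mulr_sumr -big_split /=; apply: ler_sum => y _.
  have /andP[T0 T1] := testT y.
  have h0 : 0 <= Q0 y * (1 - T y) by rewrite mulr_ge0 // subr_ge0.
  have h1 : 0 <= expR (- k') * (Q1 y * T y).
    by apply: mulr_ge0; [exact: expR_ge0 | exact: mulr_ge0].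
  case: ifPn => [h|_]; last exact: addr_ge0.
  have : 1 <= expR (- k') * expR (ell y).
    by rewrite -expRD -expR0 ler_expR addrC subr_ge0 ltW.
  rewrite Q1E; have := mulr_ge0 (Q0_ge0 y) T0.
  by move: (Q0 y) (T y) (expR _) (expR _) => a b c d; nra.
by rewrite lerD2l addrC expRD ler_pM2l ?expR_gt0.
Qed.

Lemma beta01_le (eps k : R) : \sum_(y | k < ell y) Q0 y <= eps ->
  beta eps Q0 Q1 <= expR k.
Proof.
move=> le_eps; apply: le_trans (beta_le Q1_ge0 (test_bool (fun y => k < ell y)) _) _.
- apply: le_trans le_eps; rewrite [leRHS]big_mkcond; apply: ler_sum => y _.
  by rewrite /=; case: ifP => _; rewrite ?mulr1 ?mulr0.
- apply: le_trans (sum_below_threshold_le k); rewrite [leRHS]big_mkcond.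
  apply: ler_sum => y _; rewrite (leNgt (ell y)).
  by rewrite /=; case: (k < ell y); rewrite /= ?subrr ?subr0 ?mulr0 ?mulr1.
Qed.

(** Where [k < ell], [Q1] is at least [expR k * Q0]; elsewhere the contribution of [1 - T] is
    dropped. *)
Lemma beta01_ge (eps k : R) : 0 <= eps ->
  expR k * (\sum_(y | k < ell y) Q0 y - eps) <= beta eps Q0 Q1.
Proof.
move=> eps0; apply: beta_ge => // T testT le_eps.
apply: (@le_trans _ _ (expR k * (\sum_(y | k < ell y) Q0 y - \sum_y Q0 y * T y))).
  by rewrite ler_pM2l ?expR_gt0 // lerB.
rewrite [X in _ * (X - _)]big_mkcond -sumrB mulr_sumr; apply: ler_sum => y _.
have /andP[T0 T1] := testT y; have E0 := expR_ge0 k.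
case: ifPn => [h|_].
  rewrite Q1E -mulrA -{1}[Q0 y]mulr1 -mulrBr mulrCA ler_wpM2l // ler_wpM2r ?subr_ge0 //.
  by rewrite ler_expR ltW.
apply: (@le_trans _ _ 0); last by rewrite mulr_ge0 // subr_ge0.
by rewrite sub0r mulrN oppr_le0 !mulr_ge0.
Qed.

End beta_bounds.

Lemma sum_expR_gt0 {R : realType} {Y : finType} (Q f : Y -> R) :
  (forall y, 0 <= Q y) -> \sum_y Q y = 1 -> 0 < \sum_y Q y * expR (f y).
Proof.
move=> Q0 Q1; have F0 y : 0 <= Q y * expR (f y) by rewrite mulr_ge0 // expR_ge0.
rewrite lt0r sumr_ge0 ?andbT // psumr_neq0 //.
have : \sum_y Q y != 0 by rewrite Q1 oner_neq0.
rewrite psumr_neq0 // => /hasP[y yi /= Qy]; apply/hasP; exists y => //=.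
by rewrite mulr_gt0 // expR_gt0.
Qed.

(** * Moderate deviation principle from Gaussian limits of cumulant generating functions *)

Section moderate_deviations.
Context {R : realType} (Y : nat -> finType) (Q Z : forall n, Y n -> R).
Variables (a : nat -> R) (V : R).
Arguments Q {n}.
Arguments Z {n}.
Hypothesis V_gt0 : 0 < V.
Hypothesis Q_ge0 : forall n y, 0 <= @Q n y.
Hypothesis Q_sum1 : forall n, \sum_y @Q n y = 1.
Hypothesis a_pinfty : a @ \oo --> +oo.
Hypothesis cgf_cvg : forall theta : R,
  (a n)^-1 * ln (\sum_y Q y * expR (a n * theta * @Z n y)) @[n --> \oo]
    --> V * theta ^+ 2 / 2.

Let M n theta := \sum_y Q y * expR (a n * theta * @Z n y).

Let M_gt0 n theta : 0 < M n theta.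
Proof. exact: sum_expR_gt0. Qed.

Lemma scale_near_ge (K : R) : \forall n \near \oo, K <= a n.
Proof. by move/cvgryPge : a_pinfty; apply. Qed.

Lemma mgf_near (theta e : R) : 0 < e -> \forall n \near \oo,
  expR (a n * (V * theta ^+ 2 / 2 - e)) <= M n theta <= expR (a n * (V * theta ^+ 2 / 2 + e)).
Proof.
move=> e0; have /cvgrPdist_le /(_ e e0) := @cgf_cvg theta.
apply: filterS2 (scale_near_ge 1) => n a1; rewrite -/(M n theta).
have a0 : 0 < a n by apply: lt_le_trans a1.
rewrite ler_distlC => /andP[h1 h2].
have -> : M n theta = expR (a n * ((a n)^-1 * ln (M n theta))).
  by rewrite mulrA divff ?mul1r ?lnK // ?gt_eqF // posrE.
by rewrite !ler_expR !ler_pM2l // h1 h2.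
Qed.

(** The tilt [theta] covers both plain probabilities ([theta] = 0) and exponentially tilted ones;
    the sign of [s] selects the upper or the lower tail. *)
Lemma chernoff_le n (theta s x : R) : 0 <= a n ->
  \sum_(y | 0 <= s * (@Z n y - x)) Q y * expR (a n * theta * Z y) <=
  expR (- (a n * s * x)) * M n (theta + s).
Proof.
move=> a0; rewrite big_mkcond mulr_sumr; apply: ler_sum => y _.
case: ifPn => [h|_]; last first.
  by apply: mulr_ge0; [exact: expR_ge0|apply: mulr_ge0 => //; exact: expR_ge0].
rewrite mulrCA -expRD ler_wpM2l // ler_expR -subr_ge0.
have := mulr_ge0 a0 h; lra.
Qed.

(** Chernoff at [delta / V], the minimiser of V theta^2 / 2 - theta delta. *)
Lemma deviation_le (delta e : R) : 0 < delta -> 0 < e -> \forall n \near \oo,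
  \sum_(y | delta < @Z n y) Q y <= expR (- (a n * (delta ^+ 2 / (2 * V) - e))).
Proof.
move=> d0 e0; apply: filterS2 (scale_near_ge 1) (mgf_near (delta / V) e0) => n a1 /andP[_ M1].
have a0 : 0 <= a n by apply: le_trans a1.
apply: (@le_trans _ _ (expR (- (a n * (delta / V) * delta)) * M n (delta / V))).
  have := chernoff_le 0 (delta / V) delta a0; rewrite add0r; apply: le_trans.
  rewrite big_mkcond [leRHS]big_mkcond; apply: ler_sum => y _; rewrite mulr0 mul0r expR0 mulr1.
  case: ifPn => [h|_]; last by case: ifP.
  by rewrite mulr_ge0 ?divr_ge0 ?subr_ge0 // ltW.
apply: le_trans (ler_wpM2l (expR_ge0 _) M1) _; rewrite -expRD ler_expR.
rewrite le_eqVlt; apply/orP; left; apply/eqP; field; exact: lt0r_neq0.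
Qed.

Lemma expR_near_le (c k : R) : 0 < c -> 0 < k -> \forall n \near \oo,
  expR (- (a n * k)) <= c.
Proof.
move=> c0 k0; apply: filterS (scale_near_ge (- ln c / k)) => n.
rewrite ler_pdivrMr // => h; rewrite -[leRHS]lnK ?posrE // ler_expR; lra.
Qed.

(** Tilting by [theta = x / V] centres [Z] at [x = delta + eta], strictly above [delta]. Each tail
    outside the window from [delta] to [x + eta] carries at most a quarter of the tilted mass, so
    the window keeps half of it; removing the tilt there costs at most
    [expR (a n * theta * (x + eta))]. *)
Lemma deviation_ge (delta e : R) : 0 < delta -> 0 < e -> \forall n \near \oo,
  expR (- (a n * (delta ^+ 2 / (2 * V) + e))) <= \sum_(y | delta < @Z n y) Q y.
Proof.
move=> d0 e0.
(* The total loss in the exponent is (4 delta eta + 7 eta^2 / 2) / (2 V), which is at most [e] once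
   [eta <= 1] and [eta * (4 * delta + 4) <= 2 * V * e]. *)
pose eta := Num.min 1 (2 * V * e / (4 * delta + 4)).
have dd0 : 0 < 4 * delta + 4 by lra.
have eta0 : 0 < eta by rewrite lt_min ltr01 divr_gt0 // !mulr_gt0.
have eta1 : eta <= 1 by rewrite ge_min lexx.
have etad : eta * (4 * delta + 4) <= 2 * V * e.
  by rewrite -ler_pdivlMr // ge_min lexx orbT.
pose x := delta + eta; pose theta := x / V; pose s := eta / V.
(* The shift [s] is optimal for leaving the window and gains eta^2 / (2 V) = 4 kappa. One [kappa] is
   lost on each of the two generating functions compared, leaving 2 kappa to produce the factor
   1/4. *)
pose kappa := eta ^+ 2 / (8 * V).
have k0 : 0 < kappa by rewrite divr_gt0 ?exprn_gt0 // mulr_gt0.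
have theta0 : 0 < theta by rewrite divr_gt0 // addr_gt0.
have s0 : 0 < s by rewrite divr_gt0.
have Vn0 : V != 0 by rewrite gt_eqF.
have fourth : 0 < 4^-1 :> R by rewrite invr_gt0.
have half : 0 < 2^-1 :> R by rewrite invr_gt0.
near=> n.
have a1 : 1 <= a n by near: n; exact: scale_near_ge.
have a0 : 0 <= a n by apply: le_trans a1.
have /andP[Mlo _] : expR (a n * (V * theta ^+ 2 / 2 - kappa)) <= M n theta
    <= expR (a n * (V * theta ^+ 2 / 2 + kappa)) by near: n; exact: mgf_near.
have /andP[_ Mup] : expR (a n * (V * (theta + s) ^+ 2 / 2 - kappa)) <= M n (theta + s)
    <= expR (a n * (V * (theta + s) ^+ 2 / 2 + kappa)) by near: n; exact: mgf_near.
have /andP[_ Mdn] : expR (a n * (V * (theta - s) ^+ 2 / 2 - kappa)) <= M n (theta - s)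
    <= expR (a n * (V * (theta - s) ^+ 2 / 2 + kappa)) by near: n; exact: mgf_near.
have small4 : expR (- (a n * (2 * kappa))) <= 4^-1.
  by near: n; apply: expR_near_le => //; rewrite mulr_gt0.
have small2 : expR (- (a n * kappa)) <= 2^-1 by near: n; apply: expR_near_le.
have tail (S : R) : S <= expR (a n * (V * theta ^+ 2 / 2 - 3 * kappa)) -> S <= 4^-1 * M n theta.
  move/le_trans; apply; apply: le_trans (ler_wpM2l (ltW fourth) Mlo).
  apply: le_trans (ler_wpM2r (expR_ge0 _) small4).
  by rewrite -expRD ler_expR; lra.
have up : \sum_(y | x + eta <= @Z n y) Q y * expR (a n * theta * Z y) <= 4^-1 * M n theta.
  apply: tail; have := chernoff_le theta s (x + eta) a0.
  under eq_bigl do rewrite pmulr_rge0 // subr_ge0.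
  move/le_trans; apply; apply: le_trans (ler_wpM2l (expR_ge0 _) Mup) _.
  rewrite -expRD ler_expR le_eqVlt; apply/orP; left; apply/eqP.
  by rewrite /kappa /theta /s /x; field.
have dn : \sum_(y | @Z n y <= delta) Q y * expR (a n * theta * Z y) <= 4^-1 * M n theta.
  apply: tail; have := chernoff_le theta (- s) delta a0.
  under eq_bigl do rewrite nmulr_rge0 ?oppr_lt0 // subr_le0.
  move/le_trans; apply; apply: le_trans (ler_wpM2l (expR_ge0 _) Mdn) _.
  rewrite -expRD ler_expR le_eqVlt; apply/orP; left; apply/eqP.
  by rewrite /kappa /theta /s /x; field.
(* Cut the generating function at [delta] and [x + eta]; in the window the tilting factor is bounded
   by its value at the right end. *)
have mid : M n theta <= expR (a n * theta * (x + eta)) * (\sum_(y | delta < @Z n y) Q y)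
   + \sum_(y | x + eta <= @Z n y) Q y * expR (a n * theta * Z y)
   + \sum_(y | @Z n y <= delta) Q y * expR (a n * theta * Z y).
  rewrite /M mulr_sumr [X in X + _ + _]big_mkcond [X in _ + X + _]big_mkcond.
  rewrite [X in _ + _ + X]big_mkcond -!big_split /=; apply: ler_sum => y _.
  have E0 : 0 <= Q y * expR (a n * theta * Z y) by rewrite mulr_ge0 // expR_ge0.
  have E1 : 0 <= expR (a n * theta * (x + eta)) * Q y by rewrite mulr_ge0 // expR_ge0.
  have [zd|dz] := leP (Z y) delta; first by case: ifP => _; rewrite ?add0r ?lerDr // addr0.
  have [xz|zx] := leP (x + eta) (Z y); first by rewrite addr0 lerDr.
  rewrite !addr0 mulrC ler_wpM2r // ler_expR ler_wpM2l //; last exact: ltW.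
  by rewrite mulr_ge0 // ltW.
have {mid up dn} mid : 2^-1 * M n theta <=
    expR (a n * theta * (x + eta)) * (\sum_(y | delta < @Z n y) Q y) by lra.
rewrite -(ler_pM2l (expR_gt0 (a n * theta * (x + eta)))); apply: le_trans mid.
apply: le_trans (ler_wpM2l (ltW half) Mlo).
apply: le_trans (ler_wpM2r (expR_ge0 _) small2).
rewrite -!expRD ler_expR -subr_ge0.
rewrite (_ : _ - _ = a n * (2 * V * e - (4 * delta * eta + eta ^+ 2 * 7 / 2)) / (2 * V)).
  rewrite divr_ge0 ?mulr_ge0 ?(ltW V_gt0) // subr_ge0; apply: le_trans etad; nra.
by rewrite /kappa /theta /x; field.
Unshelve. all: by end_near. Qed.

End moderate_deviations.

(** * From deviation probabilities to error exponents of tests *)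

Section moderate_beta.
Context {R : realType} (Y : nat -> finType) (Q0 Q1 Z : forall n, Y n -> R).
Variables (a b c : nat -> R) (V : R).
Arguments Q0 {n}.
Arguments Q1 {n}.
Arguments Z {n}.
Hypothesis V_gt0 : 0 < V.
Hypothesis Q0_ge0 : forall n y, 0 <= @Q0 n y.
Hypothesis Q0_sum1 : forall n, \sum_y @Q0 n y = 1.
Hypothesis Q1_near : \forall n \near \oo,
  forall y, @Q1 n y = Q0 y * expR (- c n + b n * Z y).
Hypothesis a_pinfty : a @ \oo --> +oo.
Hypothesis b_dominates : forall K : R, \forall n \near \oo, K * a n <= b n.
Hypothesis cgf_cvg : forall theta : R,
  (a n)^-1 * ln (\sum_y Q0 y * expR (a n * theta * @Z n y)) @[n --> \oo]
    --> V * theta ^+ 2 / 2.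

Let b_gt0 : \forall n \near \oo, 0 < b n.
Proof.
apply: filterS2 (scale_near_ge a_pinfty 1) (b_dominates 1) => n a1.
by rewrite mul1r; apply: lt_le_trans; apply: lt_le_trans a1.
Qed.

Let deviationE n delta : 0 < b n ->
  \sum_(y | - c n + b n * delta < - c n + b n * @Z n y) Q0 y = \sum_(y | delta < @Z n y) Q0 y.
Proof. by move=> b0; apply: eq_bigl => y; rewrite ltrD2l ltr_pM2l. Qed.

Lemma moderate_beta10 (delta : R) : 0 < delta ->
  (a n)^-1 * - ln (beta (expR (- c n + b n * delta)) (@Q1 n) (@Q0 n)) @[n --> \oo]
    --> delta ^+ 2 / (2 * V).
Proof.
move=> d0; apply/cvgrPdist_le => e e0; set I := delta ^+ 2 / (2 * V).
have [eta eta0 Ieta] : exists2 eta, 0 < eta & (delta + eta) ^+ 2 / (2 * V) <= I + e / 4.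
  have V2 : 0 < 2 * V by rewrite mulr_gt0.
  have dd : 0 < 2 * delta + 1 by lra.
  (* Chosen so that (delta + eta)^2 - delta^2 <= eta (2 delta + 1) <= V e / 2. *)
  pose eta := Num.min 1 (V * e / 2 / (2 * delta + 1)).
  have eta0 : 0 < eta by rewrite lt_min ltr01 !divr_gt0 // mulr_gt0.
  have eta1 : eta <= 1 by rewrite ge_min lexx.
  have etad : eta * (2 * delta + 1) <= V * e / 2.
    by rewrite -ler_pdivlMr // ge_min lexx orbT.
  exists eta => //; rewrite -lerBlDl /I -mulrBl ler_pdivrMr //; nra.
have e4 : 0 < e / 4 by rewrite divr_gt0.
have Ie0 : 0 <= I + e / 2 by rewrite addr_ge0 // ?divr_ge0 ?sqr_ge0 ?mulr_ge0 // ltW.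
near=> n.
have a1 : 1 <= a n by near: n; exact: scale_near_ge.
have a0 : 0 < a n by apply: lt_le_trans a1.
have b0 : 0 < b n by near: n; exact: b_gt0.
have Q1E : forall y, @Q1 n y = Q0 y * expR (- c n + b n * Z y) by near: n.
have Pup : \sum_(y | delta < @Z n y) Q0 y <= expR (- (a n * (I - e / 4))).
  by near: n; exact: deviation_le.
have Plo : expR (- (a n * ((delta + eta) ^+ 2 / (2 * V) + e / 4))) <=
    \sum_(y | delta + eta < @Z n y) Q0 y.
  by near: n; apply: deviation_ge => //; exact: addr_gt0.
have small : expR (- (a n * (e / 4))) <= 2^-1.
  by near: n; apply: expR_near_le => //; rewrite invr_gt0.
(* Makes the term subtracted in [beta10_ge], namely exp(- b_n eta), at most exp(- a_n (I + e));
   [small] then makes this at most half of the deviation probability. *)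
have dom : (I + e) / eta * a n <= b n by near: n; exact: b_dominates.
set B := beta _ _ _.
have Bup : B <= expR (- (a n * (I - e))).
  apply: (le_trans (beta10_le (@Q0_ge0 n) (@Q0_sum1 n) Q1E _)).
  rewrite deviationE //; apply: le_trans Pup _; rewrite ler_expR lerN2 ler_pM2l //; lra.
have Blo : expR (- (a n * (I + e))) <= B.
  apply: le_trans (beta10_ge (@Q0_ge0 n) Q1E _ (- c n + b n * (delta + eta))).
  rewrite deviationE // lerBrDr; apply: le_trans Plo.
  apply: (@le_trans _ _ (expR (- (a n * (I + e / 2))))); last first.
    by rewrite ler_expR lerN2 ler_pM2l //; lra.
  have h1 : expR (- c n + b n * delta - (- c n + b n * (delta + eta))) <= expR (- (a n * (I + e))).
    rewrite ler_expR; have : (I + e) * a n <= b n * eta.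
      by rewrite -ler_pdivrMr // mulrAC.
    lra.
  have h2 : expR (- (a n * (I + e))) <= expR (- (a n * (I + e / 2))) * 2^-1.
    apply: le_trans (ler_wpM2l (expR_ge0 _) small); rewrite -expRD ler_expR.
    have := mulr_gt0 a0 e0; lra.
  lra.
have B0 : 0 < B by apply: lt_le_trans Blo; exact: expR_gt0.
have lup : ln B <= - (a n * (I - e)).
  by rewrite -[leRHS]expRK ler_ln // posrE expR_gt0.
have llo : - (a n * (I + e)) <= ln B.
  by rewrite -[leLHS]expRK ler_ln // posrE expR_gt0.
rewrite ler_distlC mulrC; apply/andP; split.
  by rewrite ler_pdivlMr //; lra.
by rewrite ler_pdivrMr //; lra.
Unshelve. all: by end_near. Qed.

Lemma moderate_beta01 (r : R) : 0 < r -> forall e : R, 0 < e -> \forall n \near \oo,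
  `|- ln (beta (expR (- (a n * r))) (@Q0 n) (@Q1 n)) - (c n - Num.sqrt (2 * V * r) * b n)|
    <= e * b n.
Proof.
move=> r0 e e0; set d := Num.sqrt _.
have Vr0 : 0 < 2 * V * r by rewrite !mulr_gt0.
have d0 : 0 < d by rewrite sqrtr_gt0.
have V2 : 0 < 2 * V by rewrite mulr_gt0.
have rE : r = d ^+ 2 / (2 * V).
  by rewrite sqr_sqrtr ?(ltW Vr0) // mulrC mulKf // gt_eqF.
(* The thresholds [d + s] and [d - s] bracket the critical value [d], whose rate is exactly [r]. The
   bound [e / 2] leaves half of the allowed error for the term [a n * r], and [d / 2] keeps [d - s]
   positive. *)
pose s := Num.min (e / 2) (d / 2).
have s0 : 0 < s by rewrite lt_min !divr_gt0.
have se : s <= e / 2 by rewrite ge_min lexx.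
have sd : s <= d / 2 by rewrite ge_min lexx orbT.
pose k1 := (d + s) ^+ 2 / (2 * V) - r.
have k10 : 0 < k1 by rewrite /k1 rE -mulrBl divr_gt0 //; nra.
pose k2 := (r - (d - s) ^+ 2 / (2 * V)) / 2.
have k20 : 0 < k2 by rewrite /k2 [in X in (X - _) / 2]rE -mulrBl !divr_gt0 //; nra.
near=> n.
have a1 : 1 <= a n by near: n; exact: scale_near_ge.
have a0 : 0 < a n by apply: lt_le_trans a1.
have b0 : 0 < b n by near: n; exact: b_gt0.
have Q1E : forall y, @Q1 n y = Q0 y * expR (- c n + b n * Z y) by near: n.
have Pup : \sum_(y | d + s < @Z n y) Q0 y <= expR (- (a n * r)).
  rewrite (_ : r = (d + s) ^+ 2 / (2 * V) - k1); last by rewrite /k1; ring.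
  by near: n; apply: deviation_le => //; exact: addr_gt0.
have Plo : expR (- (a n * (r - k2))) <= \sum_(y | d - s < @Z n y) Q0 y.
  rewrite (_ : r - k2 = (d - s) ^+ 2 / (2 * V) + k2); last by rewrite /k2; field; exact: lt0r_neq0.
  by near: n; apply: deviation_ge => //; lra.
(* Gives exp(a_n k2) >= 1 + a_n k2 >= 2: the probability above [d - s] is at least twice the level,
   so subtracting the level leaves at least [expR (- (a n * r))]. *)
have ak : 1 / k2 <= a n by near: n; exact: scale_near_ge.
have dom : r / (e / 2) * a n <= b n by near: n; exact: b_dominates.
set B := beta _ _ _.
have Bup : B <= expR (- c n + b n * (d + s)).
  apply: (beta01_le (@Q0_ge0 n) (@Q0_sum1 n) Q1E).
  by rewrite deviationE.
have Blo : expR (- c n + b n * (d - s) - a n * r) <= B.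
  apply: le_trans (beta01_ge (@Q0_ge0 n) Q1E (- c n + b n * (d - s)) (expR_ge0 _)).
  rewrite deviationE // [in leLHS]expRD ler_pM2l ?expR_gt0 // lerBrDr; apply: le_trans Plo.
  rewrite (_ : - (a n * (r - k2)) = - (a n * r) + a n * k2); last by ring.
  rewrite [leRHS]expRD -mulr2n -mulr_natr ler_pM2l ?expR_gt0 //.
  apply: le_trans (expR_ge1Dx _); move: ak; rewrite ler_pdivrMr //; lra.
have B0 : 0 < B by apply: lt_le_trans Blo; exact: expR_gt0.
have lup : ln B <= - c n + b n * (d + s).
  by rewrite -[leRHS]expRK ler_ln // posrE expR_gt0.
have llo : - c n + b n * (d - s) - a n * r <= ln B.
  by rewrite -[leLHS]expRK ler_ln // posrE expR_gt0.
have are : a n * r <= b n * (e / 2).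
  by rewrite mulrC -ler_pdivrMr ?divr_gt0 // mulrAC.
have bs : b n * s <= b n * (e / 2) by rewrite ler_pM2l.
have be : 0 < b n * e by exact: mulr_gt0.
rewrite ler_norml; apply/andP; split; lra.
Unshelve. all: by end_near. Qed.

End moderate_beta.

(** * Markov chains *)

Lemma big_tuple_cons {V : nmodType} {X : finType} n (F : n.+1.-tuple X -> V) :
  \sum_s F s = \sum_x \sum_(s : n.-tuple X) F [tuple of x :: s].
Proof.
rewrite pair_bigA /= (reindex (fun p : X * n.-tuple X => [tuple of p.1 :: p.2])) //=.
exists (fun s => (thead s, [tuple of behead s])) => [[x s] _ | s _] /=.
  by rewrite theadE; congr pair; apply/val_inj.
by rewrite [RHS]tuple_eta; apply/val_inj.
Qed.

Section chains.
Context {R : realType} {X : finType}.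
Implicit Types (W : X -> X -> R) (P : X -> R).

Lemma chain_cons W P n x (s : n.+1.-tuple X) :
  chain W P n.+1 [tuple of x :: s] =
  chain W (fun y => W y x * P x) n s.
Proof.
rewrite /chain big_ord_recl tnth0 tnthS mulrA.
congr (_ * _); first by rewrite (_ : widen_ord _ _ = ord0) ?tnth0 1?mulrC //; apply/val_inj.
apply: eq_bigr => k _; rewrite tnthS; congr (W _ _).
by rewrite -[RHS](tnthS x); congr tnth; apply/val_inj.
Qed.

Lemma chain_sumP (I : finType) W (P : I -> X -> R) n (s : n.+1.-tuple X) :
  \sum_i chain W (P i) n s = chain W (fun x => \sum_i P i x) n s.
Proof. by rewrite /chain mulr_suml. Qed.

(** A left eigenvector used as terminal weight makes every transition contribute one factor [r].
    Peeling off the first state replaces the initial weight by another one, so the induction needs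
    [P] arbitrary, not normalised. *)
Lemma chain_eigen W P (u : X -> R) (r : R) n :
  (forall y, \sum_x u x * W x y = r * u y) ->
  \sum_(s : n.+1.-tuple X) chain W P n s * u (tnth s ord_max) = r ^+ n * \sum_x P x * u x.
Proof.
move=> uW; elim: n P => [|n IH] P; rewrite big_tuple_cons.
  rewrite expr0 mul1r; apply: eq_bigr => x _.
  rewrite (big_pred1 [tuple]) => [|s]; last exact/esym/eqP/tuple0.
  rewrite /chain big_ord0 mulr1 tnth0 (_ : ord_max = ord0) ?tnth0 //; exact/val_inj.
rewrite exchange_big /=.
under eq_bigr => s _.
  under eq_bigr => x _.
    rewrite chain_cons (_ : ord_max = lift ord0 ord_max); last exact/val_inj.
    rewrite tnthS.
    over.
  rewrite -mulr_suml chain_sumP.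
  over.
rewrite IH exprSr -mulrA; congr (_ * _).
rewrite [LHS](eq_bigr (fun x => \sum_y W x y * P y * u x)) => [|x _]; last first.
  by rewrite mulr_suml.
rewrite exchange_big mulr_sumr; apply: eq_bigr => y _ /=.
transitivity (P y * \sum_x u x * W x y); last by rewrite uW; ring.
by rewrite mulr_sumr; apply: eq_bigr => x _; ring.
Qed.

Definition path_sum (h : X -> R) (g : X -> X -> R) n (s : n.+1.-tuple X) : R :=
  h (tnth s ord0) +
  \sum_(k < n) g (tnth s (lift ord0 k)) (tnth s (widen_ord (leqnSn n) k)).

Lemma chain_exp W P h g (theta : R) n (s : n.+1.-tuple X) :
  chain W P n s * expR (theta * path_sum h g s) =
  chain (exp_tilt W g theta) (fun x => P x * expR (theta * h x)) n s.
Proof.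
rewrite /chain /path_sum mulrDr expRD mulr_sumr expR_sum mulrACA -big_split.
by [].
Qed.

Lemma chain_ge0 W P n (s : n.+1.-tuple X) : (forall x y, 0 <= W x y) ->
  (forall x, 0 <= P x) -> 0 <= chain W P n s.
Proof. by move=> W0 P0; rewrite mulr_ge0 // prodr_ge0. Qed.

Lemma chain_sum1 W P n : is_transition W -> is_distribution P ->
  \sum_s chain W P n s = 1.
Proof.
move=> tW [P0 P1].
have uW y : \sum_x 1 * W x y = 1 * 1.
  by under eq_bigr do rewrite mul1r; rewrite mulr1; have [] := tW y.
have := chain_eigen P n uW.
under eq_bigr do rewrite mulr1.
by under [in RHS]eq_bigr do rewrite mulr1; rewrite expr1n mul1r P1.
Qed.

End chains.

(** * Cumulant generating functions of additive path functionals *)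

Section chain_cgf.
Context {R : realType} {X : finType} (W g : X -> X -> R) (P h : X -> R) (x0 : X).
Hypothesis W_trans : is_transition W.
Hypothesis W_irr : connected_graph W.
Hypothesis P_distr : is_distribution P.

Let W_ge0 x y : 0 <= W x y.
Proof. by have [/(_ x)] := W_trans y. Qed.

Let W_neq0 : exists x y, 0 < W x y.
Proof. exact: transition_neq0 x0 W_trans. Qed.

Let P_ge0 x : 0 <= P x.
Proof. by have [] := P_distr. Qed.

(** Half of the values at 0 leaves room for continuity. A single [kappa] for all tilts near 0 is
    what keeps the later error independent of both the tilt and [n]. *)
Lemma pf_left_near_ge : exists2 kappa : R, 0 < kappa &
  \forall t \near (0 : R), forall x, kappa <= pf_left W g t x.
Proof.
pose kappa := \big[Num.min/1]_x (pf_left W g 0 x / 2).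
have u0 x : 0 < pf_left W g 0 x by exact: (pf_left_gt0 g x0 W_ge0 W_irr).
have k0 : 0 < kappa by apply: lt_bigmin => // x _; rewrite divr_gt0.
exists kappa => //.
apply: (@filter_forall _ _ (fun x t => kappa <= pf_left W g t x) (nbhs (0 : R)) _) => x.
have kx : kappa < pf_left W g 0 x.
  apply: (@le_lt_trans _ _ (pf_left W g 0 x / 2)); first exact: bigmin_le_cond.
  by rewrite ltr_pdivrMr // mulr_natr mulr2n ltrDl.
have := @pf_left_continuous R X W g x0 W_ge0 W_irr x 0.
by move/(cvgr_gt _)/(_ _ kx); apply: filterS => t /ltW.
Qed.

Lemma chain_cgf_near : exists C : R, \forall t \near (0 : R), forall n,
  `|ln (\sum_(s : n.+1.-tuple X) chain W P n s * expR (t * path_sum h g s))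
    - n%:R * ln (pf W g t)| <= C.
Proof.
have [kappa k0 near_k] := pf_left_near_ge.
pose H : R := \sum_x `|h x|.
(* [H] bounds the effect of the initial term [h] when |t| <= 1, and [- ln kappa] the cost of
   replacing the terminal weight 1 by the left eigenvector, whose values lie between [kappa] and
   1. *)
exists (H - ln kappa).
have near1 : \forall t \near (0 : R), `|t| <= 1.
  apply/nbhs_ballP; exists 1 => /= [|t]; first exact: ltr01.
  by rewrite /ball /= sub0r normrN => /ltW.
apply: filterS2 near_k near1 => t kt t1 n.
under eq_bigr do rewrite chain_exp.
set A := exp_tilt W g t; set p := fun x : X => P x * expR (t * h x).
have lam0 : 0 < pf W g t by exact: (pf_gt0 g x0 W_ge0 W_irr W_neq0).
have u1 x : pf_left W g t x <= 1.
  rewrite -(pf_left_sum1 g x0 W_ge0 W_irr t) (bigD1 x) //= lerDl.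
  by apply: sumr_ge0 => y _; apply: ltW; exact: (pf_left_gt0 g x0 W_ge0 W_irr).
have p0 x : 0 <= p x by rewrite mulr_ge0 // expR_ge0.
have A0 x y : 0 <= A x y by exact: exp_tilt_ge0.
have hH x : `|t * h x| <= H.
  rewrite normrM; apply: le_trans (ler_piMl _ t1) _ => //.
  by rewrite /H (bigD1 x) //= lerDl sumr_ge0.
have plo : expR (- H) <= \sum_x p x.
  rewrite -[leLHS]mulr1 -(proj2 P_distr) mulr_sumr.
  apply: ler_sum => x _; rewrite mulrC ler_wpM2l // ler_expR.
  by have := hH x; rewrite ler_norml => /andP[].
have pup : \sum_x p x <= expR H.
  rewrite -[leRHS]mul1r -(proj2 P_distr) mulr_suml.
  apply: ler_sum => x _; rewrite ler_wpM2l // ler_expR.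
  by have := hH x; rewrite ler_norml => /andP[].
have E := chain_eigen p n (pf_leftE g x0 W_ge0 W_irr t).
set S := \sum_s _.
have Slo : kappa * S <= pf W g t ^+ n * expR H.
  apply: (@le_trans _ _ (pf W g t ^+ n * \sum_x p x * pf_left W g t x)).
    rewrite -E mulr_sumr; apply: ler_sum => s _; rewrite mulrC ler_wpM2l //.
    exact: chain_ge0.
  rewrite ler_wpM2l ?exprn_ge0 ?(ltW lam0) //; apply: le_trans pup.
  by apply: ler_sum => x _; rewrite ler_piMr.
have Sup : pf W g t ^+ n * (kappa * expR (- H)) <= S.
  apply: (@le_trans _ _ (pf W g t ^+ n * \sum_x p x * pf_left W g t x)).
    rewrite ler_wpM2l ?exprn_ge0 ?(ltW lam0) //.
    apply: le_trans (ler_wpM2l (ltW k0) plo) _; rewrite mulr_sumr.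
    by apply: ler_sum => x _; rewrite mulrC ler_wpM2l.
  by rewrite -E; apply: ler_sum => s _; rewrite ler_piMr // chain_ge0.
have ln0 : 0 < pf W g t ^+ n by rewrite exprn_gt0.
have S0 : 0 < S by apply: lt_le_trans Sup; rewrite !mulr_gt0 ?expR_gt0.
have L : n%:R * ln (pf W g t) = ln (pf W g t ^+ n) by rewrite lnXn // mulr_natl.
rewrite L ler_norml; apply/andP; split.
  have : ln (pf W g t ^+ n * (kappa * expR (- H))) <= ln S.
    by rewrite ler_ln // posrE // !mulr_gt0 ?expR_gt0.
  rewrite !lnM ?posrE ?mulr_gt0 ?expR_gt0 // expRK; lra.
have : ln (kappa * S) <= ln (pf W g t ^+ n * expR H).
  by rewrite ler_ln // posrE !mulr_gt0 ?expR_gt0.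
rewrite !lnM ?posrE ?mulr_gt0 ?expR_gt0 // expRK; lra.
Qed.

End chain_cgf.

(** * The scales n^t, n^(1-t) and n^(1-2t) *)

Section moderate_scales.
Context {R : realType}.

Lemma powR_nat_cvgy (t : R) : 0 < t -> n%:R `^ t @[n --> \oo] --> (+oo : set_system R).
Proof.
move=> t0; apply/cvgryPge => A.
have [A0|A0] := leP A 0.
  by apply: nearW => n; apply: le_trans A0 _; exact: powR_ge0.
apply: filterS (nbhs_infty_ger (A `^ t^-1)) => n An.
rewrite -[leLHS](_ : (A `^ t^-1) `^ t = A).
  by apply: ge0_ler_powR An; rewrite ?nnegrE ?powR_ge0 // ltW.
by rewrite -powRrM mulVf ?gt_eqF // powRr1 // ltW.
Qed.

(** Expressing every scale through n^t turns the relations among them into rational identities,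
    accessible to [field]. *)
Lemma powR_nat_split (t : R) n : (0 < n)%N ->
  [/\ 0 < n%:R `^ t, n%:R `^ (1 - t) = n%:R / n%:R `^ t &
      n%:R `^ (1 - 2 * t) = n%:R / (n%:R `^ t) ^+ 2].
Proof.
move=> n0; have P x : n%:R `^ (1 - x) = n%:R / n%:R `^ x.
  rewrite powRB ?powRr1 ?ler0n //; apply/implyP => _.
  by rewrite pnatr_eq0 -lt0n.
split => //; first by rewrite powR_gt0 // ltr0n.
by rewrite P (mulrC 2) powRrM powR_mulrn ?powR_ge0.
Qed.

(** For s = theta / n^t one has n / n^(1-2t) = n^(2t), and theta^2 = s^2 n^(2t). The rescaled
    expression is therefore theta^2 times the second-order quotient of [phi] at s, up to C /
    n^(1-2t). *)
Lemma moderate_cgf_cvg (phi : R -> R) (m V t C : R) (S : nat -> R -> R) (theta : R) :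
  0 < t -> t < 1 / 2 -> phi 0 = 0 ->
  (h ^+ 2)^-1 * (phi h - phi 0 - m * h) @[h --> 0^'] --> V / 2 ->
  (\forall s \near (0 : R), forall n, `|ln (S n s) - n%:R * phi s| <= C) ->
  (n%:R `^ (1 - 2 * t))^-1 *
    (ln (S n (theta / n%:R `^ t)) - n%:R * (m * (theta / n%:R `^ t))) @[n --> \oo]
  --> V * theta ^+ 2 / 2.
Proof.
move=> t0 t1 phi0 taylor lnS.
pose s n := theta / n%:R `^ t.
have pos_near : \forall n \near \oo, (0 < n)%N by exact: nbhs_infty_gt.
have inv_cvg x : 0 < x -> (n%:R `^ x)^-1 @[n --> \oo] --> (0 : R).
  move=> x0; apply/gtr0_cvgV0; last exact: powR_nat_cvgy.
  by apply: filterS pos_near => n n0; rewrite powR_gt0 // ltr0n.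
have s_cvg : s n @[n --> \oo] --> (0 : R).
  rewrite -[X in _ --> X](mulr0 theta); apply: cvgM; first exact: cvg_cst.
  exact: inv_cvg.
have main : theta ^+ 2 * ((s n ^+ 2)^-1 * (phi (s n) - phi 0 - m * s n)) @[n --> \oo]
    --> V * theta ^+ 2 / 2.
  (* The Taylor limit is over a punctured neighbourhood, so it can be composed with [s] only when
     [theta] is nonzero. *)
  have [->|theta0] := eqVneq theta 0.
    by under eq_fun do rewrite expr0n mul0r; rewrite expr0n mulr0 mul0r; exact: cvg_cst.
  rewrite (_ : V * _ / 2 = theta ^+ 2 * (V / 2)); last by ring.
  apply: cvgM; first exact: cvg_cst.
  apply: (@cvg_comp _ _ _ s (fun h => (h ^+ 2)^-1 * (phi h - phi 0 - m * h)) _ (0 : R)^') => //.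
  move=> U /= /s_cvg; apply: filterS2 pos_near => n n0 /=; apply.
  by rewrite /s mulf_neq0 // invr_neq0 // gt_eqF // powR_gt0 // ltr0n.
have err : C * (n%:R `^ (1 - 2 * t))^-1 @[n --> \oo] --> (0 : R).
  rewrite -[X in _ --> X](mulr0 C); apply: cvgM; first exact: cvg_cst.
  by apply: inv_cvg; lra.
apply: (@squeeze_cvgr _ _ _ _
  (fun n => theta ^+ 2 * ((s n ^+ 2)^-1 * (phi (s n) - phi 0 - m * s n))
     - C * (n%:R `^ (1 - 2 * t))^-1)
  (fun n => theta ^+ 2 * ((s n ^+ 2)^-1 * (phi (s n) - phi 0 - m * s n))
     + C * (n%:R `^ (1 - 2 * t))^-1)).
- have near_s : \forall n \near \oo, forall k, `|ln (S k (s n)) - k%:R * phi (s n)| <= C.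
    exact: s_cvg lnS.
  apply: filterS2 pos_near near_s => n n0 /(_ n); rewrite -/(s n) phi0 subr0.
  have [T0 _ aE] := powR_nat_split t n0.
  have a0 : 0 < n%:R `^ (1 - 2 * t) by rewrite powR_gt0 // ltr0n.
  have nR : n%:R != 0 :> R by rewrite pnatr_eq0 -lt0n.
  have -> : theta ^+ 2 * ((s n ^+ 2)^-1 * (phi (s n) - m * s n)) =
      (n%:R `^ (1 - 2 * t))^-1 * (n%:R * phi (s n) - n%:R * (m * s n)).
    rewrite aE; have [th0|th0] := eqVneq theta 0.
      by rewrite /s th0 mul0r phi0 expr0n !mulr0 !mul0r subrr mulr0.
    have sn0 : s n != 0 by rewrite /s mulf_neq0 // invr_neq0 // gt_eqF.
    have -> : theta ^+ 2 = s n ^+ 2 * (n%:R `^ t) ^+ 2.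
      by rewrite /s -exprMn divfK // gt_eqF.
    by field; rewrite sn0 nR gt_eqF.
  rewrite ler_norml => /andP[h1 h2].
  rewrite -![_^-1 * _]mulrC -mulrBl -mulrDl !ler_pM2r ?invr_gt0 //; apply/andP; split; lra.
- by rewrite -[X in _ --> X]subr0; apply: cvgB.
- by rewrite -[X in _ --> X]addr0; apply: cvgD.
Qed.

End moderate_scales.

(** * The pair of chains: likelihood ratio, relative entropy, nondegeneracy *)

Section chain_pair.
Context {R : realType} {X : finType} (W0 W1 : X -> X -> R) (P0 P1 : X -> R) (x0 : X).
Hypothesis hW0 : is_transition W0.
Hypothesis hW1 : is_transition W1.
Hypothesis W_irr : connected_graph W0.
Hypothesis suppW : forall x y, (W0 x y == 0) = (W1 x y == 0).
Hypothesis hP0 : is_distribution P0.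
Hypothesis hP1 : is_distribution P1.
Hypothesis suppP : forall x, (P0 x == 0) = (P1 x == 0).

Local Notation g := (fun x y => ln (W1 x y / W0 x y)).
Local Notation h := (fun x => ln (P1 x / P0 x)).

Let W0_ge0 x y : 0 <= W0 x y. Proof. by have [/(_ x)] := hW0 y. Qed.
Let W1_ge0 x y : 0 <= W1 x y. Proof. by have [/(_ x)] := hW1 y. Qed.
Let P0_ge0 x : 0 <= P0 x. Proof. by have [] := hP0. Qed.
Let P1_ge0 x : 0 <= P1 x. Proof. by have [] := hP1. Qed.

Lemma expR_ln_ratio (p q : R) : 0 <= p -> 0 <= q -> (p == 0) = (q == 0) ->
  p * expR (ln (q / p)) = q.
Proof.
move=> p0 q0 pq; have [pE|pn0] := eqVneq p 0.
  by move: pq; rewrite pE mul0r eqxx => /esym/eqP.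
have pp : 0 < p by rewrite lt0r pn0.
have qq : 0 < q by rewrite lt0r -pq pn0.
by rewrite lnK ?posrE ?divr_gt0 // mulrC divfK.
Qed.

Lemma tiltE theta : tilt W0 W1 (1 - theta) theta = exp_tilt W0 g theta.
Proof.
apply/funext => x; apply/funext => y; rewrite /tilt /exp_tilt -suppW orbb.
case: ifPn => [/eqP ->|Wn0]; first by rewrite mul0r.
have W0p : 0 < W0 x y by rewrite lt0r Wn0 W0_ge0.
have W1p : 0 < W1 x y by rewrite lt0r -suppW Wn0 W1_ge0.
rewrite ln_div ?posrE // /powR -suppW (negPf Wn0) /= -expRD.
transitivity (expR (ln (W0 x y)) * expR (theta * (ln (W1 x y) - ln (W0 x y)))).
  by rewrite -expRD; congr expR; ring.
by rewrite lnK.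
Qed.

Lemma phiE : phi W0 W1 = fun theta => ln (pf W0 g theta).
Proof. by apply/funext => theta; rewrite /phi tiltE. Qed.

Lemma chain_ratio n (s : n.+1.-tuple X) :
  chain W1 P1 n s = chain W0 P0 n s * expR (path_sum h g s).
Proof.
rewrite -[path_sum _ _ _]mul1r chain_exp.
apply: (f_equal2 (fun W P => chain W P n s)).
  apply/funext => x; apply/funext => y; rewrite /exp_tilt mul1r.
  by rewrite expR_ln_ratio.
by apply/funext => x; rewrite mul1r expR_ln_ratio.
Qed.

Let W0_neq0 : exists x y, 0 < W0 x y.
Proof. exact: transition_neq0 x0 hW0. Qed.

Lemma phi_is_derive (theta : R) :
  is_derive theta (1 : R) (phi W0 W1) (dpf W0 g theta / pf W0 g theta).
Proof.
rewrite phiE mulrC.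
apply: (@is_derive1_comp _ (@ln R) (pf W0 g)); last exact: (pf_is_derive g x0 W0_ge0 W_irr).
by apply: is_derive1_ln; exact: (pf_gt0 g x0 W0_ge0 W_irr W0_neq0).
Qed.

Lemma phi0 : phi W0 W1 0 = 0.
Proof. by rewrite phiE (pf0 g x0 hW0 W_irr) ln1. Qed.

(** The curve defining the relative entropy is [phi] traversed backwards, whence the sign. *)
Lemma rel_entropyE : rel_entropy W0 W1 = - dpf W0 g 0.
Proof.
rewrite /rel_entropy (_ : (fun s => _) = phi W0 W1 \o -%R); last first.
  by apply/funext => s; rewrite /phi /= opprK.
have dN : is_derive (0 : R) 1 (-%R : R -> R) (- 1) by exact: is_deriveN.
have dp : is_derive (- (0 : R)) (1 : R) (phi W0 W1) (dpf W0 g 0).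
  have := phi_is_derive 0; rewrite (pf0 g x0 hW0 W_irr) divr1; rewrite oppr0. exact.
have [_] := is_derive1_comp dp dN.
by rewrite derive1E mulrN1 => ->.
Qed.

Lemma dphi_is_derive : is_derive (0 : R) 1 (fun theta => dpf W0 g theta / pf W0 g theta)
  ('D_1 (dpf W0 g) 0 - dpf W0 g 0 ^+ 2).
Proof.
have pf1 := pf0 g x0 hW0 W_irr.
have d1 : is_derive (0 : R) 1 (dpf W0 g) ('D_1 (dpf W0 g) 0).
  by apply: derivableP; exact: (dpf_derivable x0 W0_ge0 W_irr).
have d2 := pf_is_derive g x0 W0_ge0 W_irr 0.
have d3 : is_derive (0 : R) 1 (fun t => (pf W0 g t)^-1) (- (pf W0 g 0) ^- 2 *: dpf W0 g 0).
  by apply: is_deriveV; rewrite pf1 oner_neq0.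
apply: (is_derive_eq (is_deriveM d1 d3)); rewrite pf1.
move: ('D_1 (dpf W0 g) 0) (dpf _ _ _) => b a; rewrite /GRing.scale /= expr1n invr1; ring.
Qed.

Lemma ddphiE : derive1n 2 (phi W0 W1) 0 = 'D_1 (dpf W0 g) 0 - dpf W0 g 0 ^+ 2.
Proof.
rewrite /derive1n /= (_ : derive1 (phi W0 W1) = fun theta => dpf W0 g theta / pf W0 g theta).
  by rewrite derive1E; have [_ ->] := dphi_is_derive.
by apply/funext => theta; rewrite derive1E; have [_ ->] := phi_is_derive theta.
Qed.

(** If g = c + l x - l y on edges, the column sums of [W1] make e^l a positive left eigenvector of
    [W0] with eigenvalue e^(-c). Pairing with the stationary vector gives e^(-c) = 1; uniqueness
    then makes e^l constant, so [W1 = W0]. *)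
Lemma not_coboundary : W0 <> W1 ->
  ~ (exists (c : R) (l : X -> R), forall x y, 0 < W0 x y -> g x y = c + l x - l y).
Proof.
move=> neq [c [l gE]]; apply: neq.
have W1E x y : W1 x y = W0 x y * expR (c + l x - l y).
  have [W00|W0n0] := eqVneq (W0 x y) 0.
    by rewrite W00 mul0r; apply/eqP; rewrite -suppW W00.
  have W0p : 0 < W0 x y by rewrite lt0r W0n0 W0_ge0.
  by rewrite -gE // expR_ln_ratio.
pose w x := expR (l x).
have w0 x : 0 < w x by exact: expR_gt0.
have wW y : \sum_x w x * W0 x y = expR (- c) * w y.
  have [_] := hW1 y; under eq_bigr do rewrite W1E !expRD.
  move=> /(congr1 (fun z => z * (expR (- c) * w y))); rewrite mul1r => <-.
  rewrite mulr_suml; apply: eq_bigr => x _; rewrite /w !expRN; field.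
  by rewrite !gt_eqF ?expR_gt0.
have [pi [pi0 Wpi]] : exists pi : X -> R,
    (forall x, 0 < pi x) /\ (forall x, \sum_y W0 x y * pi y = pi x).
  exists (pf_right W0 g 0); split => x; first exact: (pf_right_gt0 g x0 W0_ge0 W_irr).
  have := pf_rightE g x0 W0_ge0 W_irr 0 x; rewrite (pf0 g x0 hW0 W_irr) mul1r => <-.
  by apply: eq_bigr => y _; rewrite exp_tilt0.
have c1 : expR (- c) = 1.
  have := dual_pairing W0 w pi; under eq_bigr do rewrite wW -mulrA.
  under [RHS]eq_bigr do rewrite Wpi.
  rewrite -mulr_sumr -[RHS]mul1r; apply: mulIf.
  by rewrite gt_eqF // (dot_gt0 x0).
have [k wk] : exists k, forall x, w x = k * 1.
  apply: (eigvec_unique (fun x y => W0_ge0 y x) (connected_tr W_irr) (r := 1)) => // y.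
    by under eq_bigr do rewrite mulr1; rewrite mulr1; have [] := hW0 y.
  by rewrite -c1 -wW; apply: eq_bigr => x _; rewrite mulrC.
apply/funext => x; apply/funext => y.
rewrite W1E -addrA expRD -[expR c]invrK -expRN c1 invr1 mul1r expRD expRN.
have wxy : w x = w y by rewrite !wk.
by rewrite -/(w x) -/(w y) wxy mulfV ?gt_eqF // mulr1.
Qed.

Lemma ddphi_gt0 : W0 <> W1 -> 0 < derive1n 2 (phi W0 W1) 0.
Proof.
move=> /not_coboundary ncob; rewrite ddphiE subr_gt0.
exact: (variance_gt0 x0 hW0 W_irr ncob).
Qed.

Lemma phi_taylor :
  (s ^+ 2)^-1 * (phi W0 W1 s - phi W0 W1 0 - dpf W0 g 0 * s) @[s --> 0^'] -->
  derive1n 2 (phi W0 W1) 0 / 2.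
Proof.
have := taylor_peano2 phi_is_derive dphi_is_derive.
by rewrite ddphiE (pf0 g x0 hW0 W_irr) divr1.
Qed.

End chain_pair.

Unset Implicit Arguments.

Theorem corollary9p4 (R : realType) (X : finType) (W0 W1 : X -> X -> R)
    (P0 P1 : X -> R) (t : R)
    (hW0 : is_transition W0) (hW1 : is_transition W1)
    (eW0 : ergodic_mx W0) (eW1 : ergodic_mx W1)
    (suppW : forall x y, (W0 x y == 0) = (W1 x y == 0))
    (neqW : W0 <> W1)
    (hP0 : is_distribution P0) (hP1 : is_distribution P1)
    (suppP : forall x, (P0 x == 0) = (P1 x == 0))
    (ht0 : 0 < t) (ht1 : t < 1 / 2) :
  (forall delta : R, 0 < delta ->
     (fun n : nat =>
        - (1 / n%:R `^ (1 - 2 * t)) *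
        ln (beta (expR (- (n%:R * rel_entropy W0 W1) + n%:R `^ (1 - t) * delta))
                 (chain W1 P1 n) (chain W0 P0 n)))
     @ \oo --> delta ^+ 2 / (2 * derive1n 2 (phi W0 W1) 0)) /\
  (forall r : R, 0 < r ->
     (fun n : nat =>
        - ln (beta (expR (- (n%:R `^ (1 - 2 * t) * r)))
                   (chain W0 P0 n) (chain W1 P1 n)))
     = (fun n : nat =>
          rel_entropy W0 W1 * n%:R
          - Num.sqrt (2 * derive1n 2 (phi W0 W1) 0 * r) * n%:R `^ (1 - t))
     +o_\oo (fun n : nat => n%:R `^ (1 - t))).
Proof.
have [x0 _] : exists x0 : X, True.
  apply: contrapT => noX; have [_ /eqP] := hP0.
  by rewrite big1 ?(eq_sym 0) ?oner_eq0 // => x _; case: noX; exists x.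
have W0_ge0 x y : 0 <= W0 x y by have [/(_ x)] := hW0 y.
have P0_ge0 x : 0 <= P0 x by have [] := hP0.
have W_irr := irreducible_connected W0_ge0 (proj1 eW0).
have V0 := ddphi_gt0 x0 hW0 hW1 W_irr suppW neqW.
have taylor := phi_taylor x0 hW0 hW1 W_irr suppW.
have entropyE := rel_entropyE x0 hW0 hW1 W_irr suppW.
set V := derive1n 2 _ 0 in V0 taylor *; set D := rel_entropy W0 W1 in entropyE *.
pose g x y := ln (W1 x y / W0 x y).
pose h x := ln (P1 x / P0 x).
pose a n : R := n%:R `^ (1 - 2 * t).
pose b n : R := n%:R `^ (1 - t).
pose c n : R := n%:R * D.
(* The log-likelihood ratio drifts by [- D] per step under [W0], so adding [c n] centres it. With
   this scaling, a_n theta Z_n is the centred ratio times theta / n^t. *)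
pose Z n (s : n.+1.-tuple X) := (path_sum h g s + c n) / b n.
have pos_near : \forall n \near \oo, (0 < n)%N by exact: nbhs_infty_gt.
have a_pinfty : a @ \oo --> +oo by apply: powR_nat_cvgy; lra.
have Q0_ge0 n s : 0 <= chain W0 P0 n s by exact: chain_ge0.
have Q0_sum1 n : \sum_s chain W0 P0 n s = 1 by exact: chain_sum1.
have b_dominates (K : R) : \forall n \near \oo, K * a n <= b n.
  have /cvgryPge/(_ K) := powR_nat_cvgy ht0; apply: filterS2 pos_near => n n0 KT.
  have [T0 bE aE] := powR_nat_split t n0.
  rewrite /a /b aE bE ler_pdivlMr //.
  rewrite [leLHS](_ : _ = K / n%:R `^ t * n%:R); last by field; rewrite gt_eqF.
  by rewrite ler_piMl // ler_pdivrMr // mul1r.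
(* Only eventually: at [n = 0] the scale [b n] is 0, and dividing by it loses the likelihood
   ratio. *)
have Q1_near : \forall n \near \oo, forall s,
    chain W1 P1 n s = chain W0 P0 n s * expR (- c n + b n * Z n s).
  apply: filterS pos_near => n n0 s.
  have b0 : b n != 0 by rewrite gt_eqF // powR_gt0 // ltr0n.
  rewrite /Z [b n * _]mulrC divfK // (addrC (- c n)) addrK.
  exact: (chain_ratio hW0 hW1 suppW hP0 hP1 suppP).
have cgf_cvg (theta : R) :
    (a n)^-1 * ln (\sum_s chain W0 P0 n s * expR (a n * theta * Z n s)) @[n --> \oo]
    --> V * theta ^+ 2 / 2.
  have [C lnS] := chain_cgf_near g h x0 hW0 W_irr hP0.
  pose S n (s : R) := \sum_(w : n.+1.-tuple X) chain W0 P0 n w * expR (s * path_sum h g w).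
  have lnS' : \forall s \near (0 : R), forall n, `|ln (S n s) - n%:R * phi W0 W1 s| <= C.
    by rewrite (phiE hW0 hW1 suppW).
  have := @moderate_cgf_cvg R _ _ _ _ _ _ theta ht0 ht1
    (phi0 x0 hW0 hW1 W_irr suppW) taylor lnS'.
  apply: cvg_trans; apply: near_eq_cvg; apply: filterS pos_near => n n0 /=.
  have [T0 bE aE] := powR_nat_split t n0.
  rewrite -/(a n); set s := theta / _; congr (_ * _).
  have S0 : 0 < S n s by exact: sum_expR_gt0.
  have nR : n%:R != 0 :> R by rewrite pnatr_eq0 -lt0n.
  (* The subtracted linear term becomes an exponential factor inside the logarithm, where it centres
     the path sum. *)
  rewrite -[LHS]expRK expRD lnK ?posrE // /S mulr_suml; congr ln.
  apply: eq_bigr => w _; rewrite -mulrA -expRD; congr (_ * expR _).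
  rewrite /Z /c entropyE /a /b aE bE /s; field.
  by rewrite nR gt_eqF.
split=> [delta delta0|r r0].
  rewrite (_ : (fun n => _) = fun n => (a n)^-1 *
      - ln (beta (expR (- c n + b n * delta)) (chain W1 P1 n) (chain W0 P0 n))); last first.
    by apply/funext => n; rewrite div1r mulNr mulrN.
  exact: (moderate_beta10 V0 Q0_ge0 Q0_sum1 Q1_near a_pinfty b_dominates cgf_cvg).
apply/eqaddoP => e e0.
have := moderate_beta01 V0 Q0_ge0 Q0_sum1 Q1_near a_pinfty b_dominates cgf_cvg r0 e0.
apply: filterS => n; rewrite [`|_ `^ _|]ger0_norm ?powR_ge0 //.
by rewrite /c [n%:R * D]mulrC.
Qed.
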